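(* Suppose $(X, \| \cdot \|)$ is a separable AM-space, and $c > 1$. Then $X$ can be equipped with an equivalent lattice norm $||| \cdot |||$ such that $\| x \| \leq ||| x ||| \leq c \| x \|$ for all $x \in X$, and the identity map is the only lattice isometry on $(X, ||| \cdot |||)$. If $X$ has no more than one atom, then $||| \cdot |||$ can be chosen to be an AM-norm.
   Context: All spaces are over the real scalars. An AM-space is a Banach lattice in which $\| x \vee y \| = \max\{ \|x\|, \|y\| \}$ for all positive $x$ and $y$; a lattice norm with this property is called an AM-norm. A lattice isometry on a normed lattice is a surjective linear isometry of the space onto itself which preserves the lattice operations. An atom is a positive nonzero element $e$ such that $0 \le x \le e$ implies that $x$ is a scalar multiple of $e$; atoms are counted up to positive scalar multiples (i.e. one counts normalized atoms). *)

(* Defs.v *)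
From HB Require Import structures.
From mathcomp Require Import all_boot all_order all_algebra.
From mathcomp Require Import all_classical all_reals all_analysis.

Set Implicit Arguments.
Unset Strict Implicit.
Unset Printing Implicit Defensive.

Import Order.TTheory GRing.Theory Num.Theory.
Import numFieldNormedType.Exports.

Local Open Scope classical_set_scope.
Local Open Scope ring_scope.

(* HB refuses a structure joining [Order.Lattice] with [GRing.Lmodule]: the
   library's [Num.RealDomain] already inherits from parts of both and no
   common join was declared below it. The order is therefore a field of this
   mixin, and [rieszType] is equipped with the library's [latticeType]
   structure a posteriori. *)
HB.mixin Record isRieszSpace (R : numDomainType) V of GRing.Lmodule R V := {
  riesz_le : rel V;
  riesz_join : V -> V -> V;
  riesz_meet : V -> V -> V;
  riesz_le_refl : reflexive riesz_le;
  riesz_le_anti : antisymmetric riesz_le;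
  riesz_le_trans : transitive riesz_le;
  riesz_leUx : forall x y z,
    riesz_le (riesz_join x y) z = riesz_le x z && riesz_le y z;
  riesz_lexI : forall x y z,
    riesz_le x (riesz_meet y z) = riesz_le x y && riesz_le x z;
  riesz_leD2r : forall x y z, riesz_le x y -> riesz_le (x + z) (y + z);
  riesz_leZ2l : forall (a : R) x y,
    0 <= a -> riesz_le x y -> riesz_le (a *: x) (a *: y) }.

#[short(type="rieszType")]
HB.structure Definition RieszSpace (R : numDomainType) :=
  { V of GRing.Lmodule R V & isRieszSpace R V }.

Section RieszLattice.
Context (R : numDomainType) (V : rieszType R).

HB.instance Definition _ := Order.Le_isPOrder.Build ring_display V
  (@riesz_le_refl R V) (@riesz_le_anti R V) (@riesz_le_trans R V).

Let leUx (x y z : V) : (riesz_join x y <= z) = (x <= z) && (y <= z).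
Proof. exact: riesz_leUx. Qed.

Let lexI (x y z : V) : (x <= riesz_meet y z) = (x <= y) && (x <= z).
Proof. exact: riesz_lexI. Qed.

HB.instance Definition _ :=
  Order.POrder_MeetJoin_isLattice.Build ring_display V lexI leUx.

End RieszLattice.
Definition modulus (R : numDomainType) (V : rieszType R) (x : V) : V :=
  Order.join x (- x).

HB.mixin Record isBanachLattice (R : numFieldType) V
    of CompleteNormedModule R V & RieszSpace R V := {
  ler_norm_modulus :
    forall x y : V, (modulus x <= modulus y)%R -> `|x| <= `|y| }.

#[short(type="banachLatticeType")]
HB.structure Definition BanachLattice (R : numFieldType) :=
  { V of CompleteNormedModule R V & RieszSpace R V & isBanachLattice R V }.

HB.instance Definition _ (R : numFieldType) (V : banachLatticeType R) :=
  Order.Lattice.copy (BanachLattice.sort V) (RieszSpace.sort V).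

Section LatticeNorms.
Context (R : realType) (V : rieszType R).
Implicit Types (N : V -> R) (x y e f : V).

Definition is_norm N : Prop :=
  [/\ forall x y, N (x + y) <= N x + N y,
      forall (a : R) x, N (a *: x) = `|a| * N x
    & forall x, N x = 0 -> x = 0].

Definition lattice_norm N : Prop :=
  is_norm N /\ forall x y, modulus x <= modulus y -> N x <= N y.

Definition AM_norm N : Prop :=
  lattice_norm N /\
  forall x y, 0 <= x -> 0 <= y -> N (Order.join x y) = Num.max (N x) (N y).

Definition equivalent_norms N1 N2 : Prop :=
  exists a b : R, [/\ 0 < a, 0 < b & forall x, a * N1 x <= N2 x <= b * N1 x].

Definition lattice_isometry N (T : {linear V -> V}) : Prop :=
  [/\ set_surj [set: V] [set: V] T,
      forall x, N (T x) = N x,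
      Order.join_morphism T
    & Order.meet_morphism T].

Definition atom e : Prop :=
  0 < e /\ forall x, 0 <= x <= e -> exists a : R, x = a *: e.

Definition at_most_one_atom : Prop :=
  forall e f, atom e -> atom f -> exists2 a : R, 0 < a & f = a *: e.

End LatticeNorms.

Definition AM_space (R : realType) (X : banachLatticeType R) : Prop :=
  AM_norm (fun x : X => `|x|).

Definition separable_space (T : topologicalType) : Prop :=
  exists2 D : set T, countable D & dense D.

Definition rigid_renorming (R : realType) (X : banachLatticeType R) (c : R)
    (N : X -> R) : Prop :=
  [/\ lattice_norm N,
      equivalent_norms (fun x : X => `|x|) N,
      forall x : X, `|x| <= N x <= c * `|x|
    & forall T : {linear X -> X}, lattice_isometry N T <-> T =1 id].

(* Main.v *)
(* Let U be the set of lattice homomorphisms f : X -> R of norm 1. A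
   minimal M-seminorm p below the norm with p(u) = |u| has the form |f| with f
   in U, so U norms X and identities in X can be checked on U.

   Attach to f in U the number I(f), the infimum over x >= 0 with f x = 1 of
   the supremum of g x over the g <> f in U; it is an invariant of the norm.
   By completeness I(f) = 0 only at the coordinate functionals of atoms, and
   by separability I(f) < 1 for countably many f only. Choose a countable set
   Phi of homomorphisms containing all those with I(f) < 1 and separating the
   points, and multiply those f in Phi with I(f) > 0 by weights
   w(f) = 1 + theta / (k f + 1), where k : Phi -> nat is injective. The
   supremum of the w(f) |f x| is an AM-norm whose unit homomorphisms are the
   w(f) f, and its invariant is I(f) / w(f): as w tends to 1, any x can be
   cut off around f until the weights of the others do not matter. For all but
   countably many theta these numbers single out each weighted f, so every
   lattice isometry fixes it; if it also fixes the atoms it is the identity.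

   A single atom is fixed automatically. When there are several, one adds the
   supremum of kap(f) |f x| + kap(g) |g x| over pairs of distinct coordinate
   functionals: the restriction of the new norm to the span of two atoms then
   reveals the injective coefficients kap, so that all atoms are fixed. *)
Require Import Defs.
From mathcomp Require Import all_boot all_order all_algebra.
From mathcomp Require Import all_classical all_reals all_analysis.
From mathcomp Require Import ring lra.
Import Order.TTheory GRing.Theory Num.Theory.
Import numFieldNormedType.Exports.
Set Implicit Arguments.
Unset Strict Implicit.
Unset Printing Implicit Defensive.
Local Open Scope classical_set_scope.
Local Open Scope ring_scope.

(** * Order arithmetic, positive parts and moduli in Riesz spaces *)

Section Riesz.
Context (R : realType) (V : rieszType R).
Implicit Types (x y z u v : V) (a b : R).

Lemma rleD2r z x y : (x + z <= y + z) = (x <= y).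
Proof.
apply/idP/idP => [h|]; last exact: riesz_leD2r.
have : x + z + - z <= y + z + - z by exact: riesz_leD2r.
by rewrite !addrK.
Qed.

Lemma rleD2l z x y : (z + x <= z + y) = (x <= y).
Proof. by rewrite ![z + _]addrC rleD2r. Qed.

Lemma rsubr_ge0 x y : (0 <= y - x) = (x <= y).
Proof. by rewrite -[LHS](rleD2r x) add0r subrK. Qed.

Lemma rleD x y u v : x <= y -> u <= v -> x + u <= y + v.
Proof. by move=> xy uv; apply: (@le_trans _ _ (y + u)); rewrite ?rleD2r ?rleD2l. Qed.

Lemma raddr_ge0 x y : 0 <= x -> 0 <= y -> 0 <= x + y.
Proof. by move=> x0 y0; rewrite -[0]addr0; apply: rleD. Qed.

Lemma rlerBlDr x y z : (x - y <= z) = (x <= z + y).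
Proof. by rewrite -[LHS](rleD2r y) subrK. Qed.

Lemma rlerBrDr x y z : (x <= y - z) = (x + z <= y).
Proof. by rewrite -[LHS](rleD2r z) subrK. Qed.

Lemma rleN2 x y : (- x <= - y) = (y <= x).
Proof. by rewrite -[LHS](rleD2r (x + y)) addKr addrCA addNr addr0. Qed.

Lemma rlerNr x y : (x <= - y) = (y <= - x).
Proof. by rewrite -[LHS]rleN2 opprK. Qed.

Lemma rleZ2l a x y : 0 <= a -> x <= y -> a *: x <= a *: y.
Proof. exact: riesz_leZ2l. Qed.

Lemma rscale_ge0 a x : 0 <= a -> 0 <= x -> 0 <= a *: x.
Proof. by move=> a0 x0; rewrite -(scaler0 _ a); apply: rleZ2l. Qed.

Lemma rlepZ2l a x y : 0 < a -> (a *: x <= a *: y) = (x <= y).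
Proof.
move=> a0; apply/idP/idP => [h|]; last by apply: rleZ2l; exact: ltW.
have := rleZ2l (ltW (etrans (invr_gt0 a) a0)) h.
by rewrite !scalerA mulVf ?gt_eqF// !scale1r.
Qed.

Lemma joinDr x y z : Order.join x y + z = Order.join (x + z) (y + z).
Proof.
apply/eqP; rewrite eq_le leUx !rleD2r leUl leUr /= andbT.
by rewrite -rlerBrDr leUx !rlerBrDr leUl leUr.
Qed.

Lemma opp_join x y : - Order.join x y = Order.meet (- x) (- y).
Proof.
apply/eqP; rewrite eq_le lexI !rleN2 leUl leUr /=.
by rewrite rlerNr leUx (rlerNr x) (rlerNr y) leIl leIr.
Qed.

Lemma meetE x y : Order.meet x y = - Order.join (- x) (- y).
Proof. by rewrite opp_join !opprK. Qed.

Lemma joinZ a x y : 0 <= a -> a *: Order.join x y = Order.join (a *: x) (a *: y).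
Proof.
rewrite le_eqVlt => /predU1P[<-|a0]; first by rewrite !scale0r joinxx.
apply/eqP; rewrite eq_le leUx !(rleZ2l (ltW a0)) ?leUl ?leUr //= andbT.
rewrite -(rlepZ2l _ _ (etrans (invr_gt0 a) a0)) scalerA mulVf ?gt_eqF// scale1r.
by rewrite leUx -!(rlepZ2l _ (_^-1 *: _) a0) !scalerA mulfV ?gt_eqF// !scale1r leUl leUr.
Qed.

Definition ppart x : V := Order.join x 0.

Lemma ppart_ge0 x : 0 <= ppart x. Proof. exact: leUr. Qed.
Lemma le_ppart x : x <= ppart x. Proof. exact: leUl. Qed.

Lemma ppart_le x y : 0 <= y -> x <= y -> ppart x <= y.
Proof. by move=> y0 xy; rewrite leUx xy y0. Qed.

Lemma le_ppart2 x y : x <= y -> ppart x <= ppart y.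
Proof. by move=> xy; rewrite leU2. Qed.

Lemma ppart_id x : 0 <= x -> ppart x = x.
Proof. by move=> x0; apply/join_idPl. Qed.

Lemma ppartZ a x : 0 <= a -> ppart (a *: x) = a *: ppart x.
Proof. by move=> a0; rewrite /ppart joinZ// scaler0. Qed.

Lemma ppart_sub x : ppart x - ppart (- x) = x.
Proof.
apply/eqP; rewrite subr_eq; apply/eqP.
by rewrite addrC /ppart joinDr addNr add0r joinC.
Qed.

Lemma ppart_disj x : Order.meet (ppart x) (ppart (- x)) = 0.
Proof.
have -> : ppart x = x + ppart (- x) by rewrite -{2}(ppart_sub x) subrK.
rewrite meetE opprD -[X in Order.join _ X]add0r -joinDr opprD opprK.
by rewrite -/(ppart _) addNr.
Qed.

Lemma modulus_ge x : x <= modulus x. Proof. exact: leUl. Qed.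
Lemma modulusN_ge x : - x <= modulus x. Proof. exact: leUr. Qed.

Lemma modulus_ge0 x : 0 <= modulus x.
Proof.
have : 0 <= 2 *: modulus x.
  by rewrite scaler_nat mulr2n -(subrr x) rleD ?modulus_ge ?modulusN_ge.
by rewrite -{1}(scaler0 _ 2) rlepZ2l.
Qed.

Lemma modulus_le x y : (modulus x <= y) = (x <= y) && (- x <= y).
Proof. exact: leUx. Qed.

Lemma modulus_id x : 0 <= x -> modulus x = x.
Proof.
move=> x0; apply/join_idPl; apply: (le_trans _ x0).
by rewrite -oppr0 rleN2.
Qed.

Lemma modulusN x : modulus (- x) = modulus x.
Proof. by rewrite /modulus opprK joinC. Qed.

Lemma modulus_modulus x : modulus (modulus x) = modulus x.
Proof. exact/modulus_id/modulus_ge0. Qed.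

Lemma modulusZ a x : modulus (a *: x) = `|a| *: modulus x.
Proof.
have [a0|a0] := leP 0 a; first by rewrite /modulus joinZ ?scalerN ?ger0_norm.
rewrite -modulusN -scaleNr /modulus joinZ ?scalerN ?ltr0_norm //.
by rewrite oppr_ge0 ltW.
Qed.

Lemma modulusD x y : modulus (x + y) <= modulus x + modulus y.
Proof. by rewrite modulus_le opprD !rleD ?modulus_ge ?modulusN_ge. Qed.

Lemma modulus_le_ppart x : modulus x <= ppart x + ppart (- x).
Proof.
rewrite modulus_le -{1}[x]addr0 -{2}[- x]add0r !rleD ?le_ppart ?ppart_ge0//.
Qed.

(** Both [x] and [y] lie below the join of [u] and [v] plus the two moduli. This Lipschitz bound
    later shows that a functional determined up to a null error preserves joins. *)
Lemma modulus_joinB x y u v :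
  modulus (Order.join x y - Order.join u v) <= modulus (x - u) + modulus (y - v).
Proof.
have aux (p q r s : V) : Order.join p q - Order.join r s <= modulus (p - r) + modulus (q - s).
  rewrite rlerBlDr leUx; apply/andP; split.
    rewrite -[p](subrK r) rleD ?leUl//.
    by rewrite subrK -[X in X <= _]addr0 rleD ?modulus_ge ?modulus_ge0.
  rewrite -[q](subrK s) rleD ?leUr//.
  by rewrite subrK -[X in X <= _]add0r rleD ?modulus_ge ?modulus_ge0.
rewrite modulus_le aux opprB; apply: le_trans (aux _ _ _ _) _.
by rewrite -[modulus (u - x)]modulusN -[modulus (v - y)]modulusN !opprB.
Qed.

End Riesz.

(** * M-seminorms and the existence of minimal ones *)

Section Mseminorms.
Context (R : realType) (V : rieszType R).
Implicit Types (x y z u v w : V) (a b : R) (p q : V -> R).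

(** Definiteness is not asked for, so that the class is closed under the infima below. In
    [MseminormU] only one inequality is stated; the other follows from monotonicity. *)
Record Mseminorm p : Prop := {
  MseminormD : forall x y, p (x + y) <= p x + p y;
  MseminormZ : forall a x, p (a *: x) = `|a| * p x;
  Mseminorm_mono : forall x y, modulus x <= modulus y -> p x <= p y;
  MseminormU : forall x y, 0 <= x -> 0 <= y ->
    p (Order.join x y) <= Num.max (p x) (p y) }.

Section basics.
Variables (p : V -> R) (Mp : Mseminorm p).

Lemma Mseminorm0 : p 0 = 0.
Proof. by rewrite -(scale0r 0) (MseminormZ Mp) normr0 mul0r. Qed.

Lemma Mseminorm_ge0 x : 0 <= p x.
Proof.
rewrite -Mseminorm0; apply: (Mseminorm_mono Mp).
by rewrite (modulus_id (lexx _)) modulus_ge0.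
Qed.

Lemma Mseminorm_modulus x : p (modulus x) = p x.
Proof. by apply/eqP; rewrite eq_le !(Mseminorm_mono Mp) ?modulus_modulus. Qed.

Lemma Mseminorm_le x y : 0 <= x -> x <= y -> p x <= p y.
Proof.
move=> x0 xy; apply: (Mseminorm_mono Mp); rewrite !modulus_id//.
exact: le_trans xy.
Qed.

Lemma MseminormZp a x : 0 <= a -> p (a *: x) = a * p x.
Proof. by move=> a0; rewrite (MseminormZ Mp) ger0_norm. Qed.

Lemma Mseminorm_ppart_le x y z : 0 <= y -> x <= y + z -> p (ppart x) <= p y + p (ppart z).
Proof.
move=> y0 xyz; apply: le_trans (MseminormD Mp _ _).
apply: Mseminorm_le; first exact: ppart_ge0.
apply: ppart_le; first by apply: raddr_ge0 => //; exact: ppart_ge0.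
by apply: le_trans xyz _; rewrite rleD2l le_ppart.
Qed.

End basics.

(* The hypotheses relate different members of [F], so that the lemma applies
   both to chains and to the maps [w |-> p (ppart (modulus w - a *: x))], which
   are not seminorms individually. *)
Lemma inf_Mseminorm (F : set (V -> R)) :
  F !=set0 ->
  (forall p, F p -> forall x, 0 <= p x) ->
  (forall p, F p -> forall x y, modulus x <= modulus y -> p x <= p y) ->
  (forall p a, F p -> exists2 q, F q & forall x, q (a *: x) <= `|a| * p x) ->
  (forall p q, F p -> F q -> exists2 r, F r & forall x y, r (x + y) <= p x + q y) ->
  (forall p q, F p -> F q -> exists2 r, F r & forall x y, 0 <= x -> 0 <= y ->
     r (Order.join x y) <= Num.max (p x) (q y)) ->
  Mseminorm (fun x => inf [set p x | p in F]).
Proof.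
move=> [p0 Fp0] F0 Fmono FZ FD FU.
have ne x : [set p x | p in F] !=set0 by exists (p0 x), p0.
have lb x : has_lbound [set p x | p in F].
  by exists 0 => _ [p Fp <-]; exact: F0.
have le_p p x : F p -> inf [set p x | p in F] <= p x.
  by move=> Fp; apply: ge_inf => //; exists p.
have inf_e x e : 0 < e -> exists2 p, F p & p x < inf [set p x | p in F] + e.
  move=> e0; have [_ [p Fp <-] lt_p] := inf_adherent e0 (conj (ne x) (lb x)).
  by exists p.
have inf0 x : 0 <= inf [set p x | p in F].
  by apply: lb_le_inf => // _ [p Fp <-]; exact: F0.
have infZ a x : inf [set p (a *: x) | p in F] <= `|a| * inf [set p x | p in F].
  apply/ler_addgt0Pr => e e0.
  have e'0 : 0 < e / (`|a| + 1) by rewrite divr_gt0// ltr_wpDl.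
  have [p Fp ltp] := inf_e x _ e'0.
  have [q Fq qle] := FZ p a Fp.
  apply: le_trans (le_p q _ Fq) _; apply: le_trans (qle _) _.
  apply: le_trans (ler_wpM2l (normr_ge0 a) (ltW ltp)) _.
  rewrite mulrDr lerD2l mulrCA ler_piMr ?(ltW e0)//.
  by rewrite ler_pdivrMr ?ltr_wpDl// mul1r lerDl.
split.
- move=> x y; apply/ler_addgt0Pr => e e0.
  have e'0 : 0 < e / 2 by rewrite divr_gt0.
  have [p Fp ltp] := inf_e x _ e'0.
  have [q Fq ltq] := inf_e y _ e'0.
  have [r Fr rle] := FD _ _ Fp Fq.
  apply: le_trans (le_p r _ Fr) _; apply: le_trans (rle _ _) _; lra.
- move=> a x; apply/eqP; rewrite eq_le infZ /=.
  have [->|a0] := eqVneq a 0; first by rewrite normr0 mul0r.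
  have := infZ a^-1 (a *: x).
  rewrite scalerA mulVf// scale1r normfV.
  by rewrite ler_pdivlMl ?normr_gt0.
- move=> x y xy; apply: lb_le_inf => // _ [p Fp <-].
  by apply: le_trans (le_p p _ Fp) _; exact: Fmono.
- move=> x y x0 y0; apply/ler_addgt0Pr => e e0.
  have [p Fp ltp] := inf_e x _ e0.
  have [q Fq ltq] := inf_e y _ e0.
  have [r Fr rle] := FU _ _ Fp Fq.
  apply: le_trans (le_p r _ Fr) _; apply: le_trans (rle _ _ x0 y0) _.
  by rewrite addr_maxl ge_max !le_max (ltW ltp) (ltW ltq) orbT.
Qed.

Lemma minimal_Mseminorm N u : Mseminorm N -> exists p,
  [/\ Mseminorm p, forall x, p x <= N x, p u = N u &
    forall q, Mseminorm q -> (forall x, q x <= p x) -> q u = N u ->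
      forall x, p x <= q x].
Proof.
move=> MN.
pose P p := [/\ Mseminorm p, forall x, p x <= N x & p u = N u].
pose T := {p : V -> R | P p}.
pose t0 : T := exist P N (And3 MN (fun x => lexx _) erefl).
(* The order is reversed: the maximal element given by Zorn's lemma is a minimal seminorm, and
   chains are bounded by their pointwise infima. *)
pose D (s t : T) := `[< forall x, sval t x <= sval s x >].
have [|||p pmin] := @ZL_preorder T t0 D.
- by move=> t; apply/asboolP.
- move=> r s t /asboolP rs /asboolP st; apply/asboolP => x.
  exact: le_trans (rs x).
- move=> A totA.
  have [A0|/set0P[s0 As0]] := eqVneq A set0.
    by exists t0 => s; rewrite A0.
  pose F := [set sval s | s in A].
  have F0 : F !=set0 by exists (sval s0), s0.
  have FM p : F p -> Mseminorm p by case=> s _ <-; case: (svalP s).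
  have F_total p q : F p -> F q -> exists r, [/\ F r,
      forall x, r x <= p x & forall x, r x <= q x].
    move=> [s As <-] [t At <-].
    have [/asboolP st|/asboolP ts] := totA _ _ As At.
      by exists (sval t); split => //; exists t.
    by exists (sval s); split => //; exists s.
  have MF : Mseminorm (fun x => inf [set p x | p in F]).
    apply: inf_Mseminorm => //.
    + by move=> p /FM Mp x; exact: Mseminorm_ge0.
    + by move=> p /FM Mp; exact: Mseminorm_mono.
    + by move=> p a Fp; exists p => // x; rewrite (MseminormZ (FM _ Fp)).
    + move=> p q Fp Fq; have [r [Fr rp rq]] := F_total _ _ Fp Fq.
      exists r => // x y; apply: le_trans (MseminormD (FM _ Fr) _ _) _.
      exact: lerD.
    + move=> p q Fp Fq; have [r [Fr rp rq]] := F_total _ _ Fp Fq.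
      exists r => // x y x0 y0; apply: le_trans (MseminormU (FM _ Fr) x0 y0) _.
      by rewrite ge_max !le_max rp rq orbT.
  have le_p s x : A s -> inf [set p x | p in F] <= sval s x.
    move=> As; apply: ge_inf; last by exists (sval s) => //; exists s.
    by exists 0 => _ [p /FM Mp <-]; exact: Mseminorm_ge0.
  have Fle x : inf [set p x | p in F] <= N x.
    by apply: le_trans (le_p s0 x As0) _; case: (svalP s0).
  have Fu : inf [set p u | p in F] = N u.
    suff -> : [set p u | p in F] = [set N u] by rewrite inf1.
    apply/seteqP; split => [_ [_ [s As <-] <-]|_ ->]; first by case: (svalP s).
    by exists (sval s0); [exists s0|case: (svalP s0)].
  exists (exist P _ (And3 MF Fle Fu)) => s As; apply/asboolP => x /=.
  exact: le_p.
- have [Mp pN pu] := svalP p.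
  exists (sval p); split => // q Mq qp qu.
  have qN x : q x <= N x by exact: le_trans (pN x).
  have := pmin (exist P _ (And3 Mq qN qu)).
  by rewrite /D /= => /(_ (asboolT qp))/asboolP.
Qed.

End Mseminorms.

(** * Lattice homomorphisms obtained from minimal M-seminorms *)

Section LatticeHoms.
Context (R : realType) (V : rieszType R).
Implicit Types (x y z u v w : V) (a b : R) (p q : V -> R).

Lemma ppart_modulus_subD x y z a b :
  ppart (modulus (x + y) - (a + b) *: z) <=
  ppart (modulus x - a *: z) + ppart (modulus y - b *: z).
Proof.
apply: ppart_le; first by apply: raddr_ge0; exact: ppart_ge0.
apply: (@le_trans _ _ ((modulus x - a *: z) + (modulus y - b *: z))).
  by rewrite addrACA -opprD -scalerDl rleD2r modulusD.
by rewrite rleD// le_ppart.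
Qed.

Lemma ppart_join_sub x y z :
  ppart (Order.join x y - z) = Order.join (ppart (x - z)) (ppart (y - z)).
Proof. by rewrite /ppart joinDr joinACA joinxx. Qed.

(** This is [p] with the multiples of [x] divided out: it lies below [p] and vanishes at [x]. If [a]
    serves for one vector and [b] for another, [a + b] serves for their sum and their join. *)
Lemma Mseminorm_sub p x : Mseminorm p -> 0 <= x ->
  Mseminorm (fun w => inf [set q w | q in
    [set (fun w => p (ppart (modulus w - a *: x))) | a in [set a : R | 0 <= a]]]).
Proof.
move=> Mp x0; apply: inf_Mseminorm.
- by exists (fun w => p (ppart (modulus w - 0 *: x))), 0 => /=.
- by move=> _ [a _ <-] w; exact: Mseminorm_ge0.
- move=> _ [a a0 <-] w z wz; apply: (Mseminorm_le Mp); first exact: ppart_ge0.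
  by apply: le_ppart2; rewrite rleD2r.
- move=> _ b [a a0 <-]; exists (fun w => p (ppart (modulus w - (`|b| * a) *: x))).
    by exists (`|b| * a) => //=; rewrite mulr_ge0.
  move=> w; rewrite modulusZ -scalerA -scalerBr ppartZ// (MseminormZp Mp)//.
- move=> _ _ [a /= a0 <-] [b /= b0 <-].
  exists (fun w => p (ppart (modulus w - (a + b) *: x))).
    by exists (a + b) => //=; rewrite addr_ge0.
  move=> w z; apply: le_trans (MseminormD Mp _ _).
  by apply: (Mseminorm_le Mp); [exact: ppart_ge0|exact: ppart_modulus_subD].
- move=> _ _ [a /= a0 <-] [b /= b0 <-].
  exists (fun w => p (ppart (modulus w - (a + b) *: x))).
    by exists (a + b) => //=; rewrite addr_ge0.
  move=> w z w0 z0; rewrite !modulus_id//; last by apply: le_trans w0 (leUl _ _).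
  rewrite ppart_join_sub.
  apply: le_trans (MseminormU Mp (ppart_ge0 _) (ppart_ge0 _)) _.
  rewrite ge_max !le_max; apply/andP; split; apply/orP; [left|right].
    apply: (Mseminorm_le Mp); first exact: ppart_ge0.
    by apply: le_ppart2; rewrite rleD2l rleN2 scalerDl -[X in X <= _]addr0 rleD2l rscale_ge0.
  apply: (Mseminorm_le Mp); first exact: ppart_ge0.
  by apply: le_ppart2; rewrite rleD2l rleN2 scalerDl -[X in X <= _]add0r rleD2r rscale_ge0.
Qed.

Definition minimal_at p u := Mseminorm p /\
  forall q, Mseminorm q -> (forall x, q x <= p x) -> q u = p u ->
    forall x, p x <= q x.

(** Otherwise the seminorm of [Mseminorm_sub] would keep the value at [u], hence dominate [p] by
    minimality, although it vanishes at [x]. *)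
Lemma minimal_sub_lt p u x : minimal_at p u -> 0 <= u -> 0 <= x -> 0 < p x ->
  exists2 a, 0 <= a & p (ppart (u - a *: x)) < p u.
Proof.
move=> [Mp minp] u0 x0 px0; apply: contrapT => nex.
have lbF w : has_lbound [set q w | q in
    [set (fun w => p (ppart (modulus w - a *: x))) | a in [set a : R | 0 <= a]]].
  by exists 0 => _ [_ [a _ <-] <-]; exact: Mseminorm_ge0.
have F0 w : [set q w | q in
    [set (fun w => p (ppart (modulus w - a *: x))) | a in [set a : R | 0 <= a]]] (p w).
  exists (fun w => p (ppart (modulus w - 0 *: x))); first by exists 0 => /=.
  by rewrite scale0r subr0 ppart_id ?modulus_ge0// Mseminorm_modulus.
have := minp _ (Mseminorm_sub Mp x0) (fun w => ge_inf (lbF w) (F0 w)).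
suff -> : inf [set q u | q in
    [set (fun w => p (ppart (modulus w - a *: x))) | a in [set a : R | 0 <= a]]] = p u.
  move=> /(_ erefl x); apply/negP; rewrite -ltNge; apply: le_lt_trans px0.
  apply: ge_inf => //; exists (fun w => p (ppart (modulus w - 1 *: x))).
    by exists 1 => /=.
  by rewrite scale1r modulus_id// subrr ppart_id// Mseminorm0.
apply/eqP; rewrite eq_le; apply/andP; split; first exact: ge_inf.
apply: lb_le_inf; first by exists (p u); exact: F0.
move=> _ [_ [a /= a0 <-] <-]; rewrite modulus_id// leNgt; apply/negP => h.
by apply: nex; exists a.
Qed.

Lemma minimal_disjoint p u x y : minimal_at p u -> 0 <= u -> 0 < p u ->
  0 <= x -> 0 <= y -> Order.meet x y = 0 -> p x = 0 \/ p y = 0.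
Proof.
move=> minp u0 pu0 x0 y0 xy0; have [Mp _] := minp.
have [px0|] := eqVneq (p x) 0; first by left.
have [py0|] := eqVneq (p y) 0; first by right.
move=> py px; exfalso.
have px0 : 0 < p x by rewrite lt_neqAle eq_sym px Mseminorm_ge0.
have py0 : 0 < p y by rewrite lt_neqAle eq_sym py Mseminorm_ge0.
have [a a0 pa] := minimal_sub_lt minp u0 x0 px0.
have [b b0 pb] := minimal_sub_lt minp u0 y0 py0.
pose c := Num.max a b.
have c0 : 0 <= c by rewrite le_max a0.
(* [(u - c x)^+] and [(u - c y)^+] have join [(u - c (x /\ y))^+ = u], but both
   have a smaller value than [u] under [p]. *)
have uE : u = Order.join (ppart (u - c *: x)) (ppart (u - c *: y)).
  rewrite /ppart joinACA joinxx ![u - _]addrC -joinDr.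
  have -> : Order.join (- (c *: x)) (- (c *: y)) = 0.
    by rewrite -!scalerN -joinZ// -[Order.join _ _]opprK -meetE xy0 oppr0 scaler0.
  by rewrite add0r; apply/esym/join_idPl.
have : p u <= Num.max (p (ppart (u - c *: x))) (p (ppart (u - c *: y))).
  by rewrite {1}uE; apply: (MseminormU Mp); exact: ppart_ge0.
apply/negP; rewrite -ltNge gt_max; apply/andP; split.
  apply: le_lt_trans pa; apply: (Mseminorm_le Mp); first exact: ppart_ge0.
  apply: le_ppart2; rewrite rleD2l rleN2 -rsubr_ge0 -scalerBl rscale_ge0//.
  by rewrite subr_ge0 le_max lexx.
apply: le_lt_trans pb; apply: (Mseminorm_le Mp); first exact: ppart_ge0.
apply: le_ppart2; rewrite rleD2l rleN2 -rsubr_ge0 -scalerBl rscale_ge0//.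
by rewrite subr_ge0 le_max lexx orbT.
Qed.

(** The positive parts of [w - a *: u] and of its opposite are disjoint, so for every [a] one of
    them is null ([dich]). Testing [a] slightly off [p w] shows that both are null at [a = p w]. *)
Lemma minimal_proportional_pos p u w : minimal_at p u -> 0 <= u -> p u = 1 ->
  0 <= w -> p (w - p w *: u) = 0.
Proof.
move=> minp u0 pu1 w0; have [Mp _] := minp.
have dich a : p (ppart (w - a *: u)) = 0 \/ p (ppart (a *: u - w)) = 0.
  rewrite -[a *: u - w]opprB.
  by apply: (minimal_disjoint minp);
    rewrite ?pu1 ?ppart_ge0 ?ppart_disj.
set s := p w.
have s0 : 0 <= s by exact: Mseminorm_ge0.
have pos : p (ppart (w - s *: u)) = 0.
  set d := p _; apply/eqP; rewrite eq_le {2}/d Mseminorm_ge0// andbT leNgt.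
  apply/negP => d0; pose a := s + d / 2.
  have a0 : 0 <= a by rewrite addr_ge0// divr_ge0// ltW.
  have : d <= d / 2 * p u + p (ppart (w - a *: u)).
    rewrite -(MseminormZp Mp) ?divr_ge0 ?(ltW d0)//.
    apply: Mseminorm_ppart_le => //.
      by rewrite rscale_ge0// divr_ge0// ltW.
    by rewrite /a scalerDl opprD (addrA w) [X in _ <= X]addrC subrK.
  have [->|h] := dich a; first by rewrite pu1; lra.
  have : a * p u <= p w + p (ppart (a *: u - w)).
    rewrite -(MseminormZp Mp)// -{1}(ppart_id (rscale_ge0 a0 u0)).
    by apply: Mseminorm_ppart_le => //; rewrite [X in _ <= X]addrC subrK.
  rewrite h pu1 /a -/s; lra.
have neg : p (ppart (s *: u - w)) = 0.
  set d := p _; apply/eqP; rewrite eq_le {2}/d Mseminorm_ge0// andbT leNgt.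
  apply/negP => d0; pose a := s - d / 2.
  have ds : d <= s.
    rewrite -[s]mulr1 -pu1 -(MseminormZp Mp)//.
    apply: (Mseminorm_le Mp); first exact: ppart_ge0.
    by apply: ppart_le; rewrite ?rscale_ge0// rlerBlDr -[X in X <= _]addr0 rleD2l.
  have a0 : 0 <= a by rewrite /a; lra.
  have : d <= d / 2 * p u + p (ppart (a *: u - w)).
    rewrite -(MseminormZp Mp) ?divr_ge0 ?(ltW d0)//.
    apply: Mseminorm_ppart_le => //.
      by rewrite rscale_ge0// divr_ge0// ltW.
    by rewrite /a scalerBl (addrAC (s *: u)) [X in _ <= X]addrC subrK.
  have [h|->] := dich a; last by rewrite pu1; lra.
  have : p w <= a * p u + p (ppart (w - a *: u)).
    rewrite -(MseminormZp Mp)// -{1}(ppart_id w0).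
    by apply: Mseminorm_ppart_le => //; rewrite ?rscale_ge0// [X in _ <= X]addrC subrK.
  rewrite h pu1 /a -/s; lra.
apply/eqP; rewrite eq_le Mseminorm_ge0// andbT -(Mseminorm_modulus Mp).
apply: le_trans (Mseminorm_le Mp (modulus_ge0 _) (modulus_le_ppart _)) _.
by apply: le_trans (MseminormD Mp _ _) _; rewrite opprB pos neg addr0.
Qed.

Lemma minimal_proportional p u w : minimal_at p u -> 0 <= u -> p u = 1 ->
  exists a, p (w - a *: u) = 0.
Proof.
move=> minp u0 pu1; have [Mp _] := minp.
exists (p (ppart w) - p (ppart (- w))).
apply/eqP; rewrite eq_le Mseminorm_ge0// andbT.
have -> : w - (p (ppart w) - p (ppart (- w))) *: u =
    (ppart w - p (ppart w) *: u) + (- 1) *: (ppart (- w) - p (ppart (- w)) *: u).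
  rewrite -{1}[w]ppart_sub scalerBl scaleN1r !opprB addrACA [RHS]addrACA.
  by congr (_ + _); rewrite addrC.
apply: le_trans (MseminormD Mp _ _) _.
rewrite (MseminormZ Mp).
by rewrite !(minimal_proportional_pos minp)// ?ppart_ge0// mulr0 addr0.
Qed.

Record lattice_hom (f : V -> R) : Prop := {
  lattice_homD : forall x y, f (x + y) = f x + f y;
  lattice_homZ : forall a x, f (a *: x) = a * f x;
  lattice_homU : forall x y, f (Order.join x y) = Num.max (f x) (f y) }.

(** Modulo the null vectors of a minimal [p] every [w] is a multiple of [u], and [f w] is its
    coefficient. The coefficient is unique because [p u = 1] ([fE]), so each algebraic law reduces
    to the nullity of one vector. *)
Lemma exists_lattice_hom1 N u : Mseminorm N -> 0 <= u -> N u = 1 ->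
  exists f, [/\ lattice_hom f, forall x, f x <= N x & f u = 1].
Proof.
move=> MN u0 Nu1; have [p [Mp pN pu pmin]] := minimal_Mseminorm u MN.
rewrite Nu1 in pu.
have minp : minimal_at p u by split => // q Mq qp qu; apply: pmin => //; rewrite qu pu.
have [f fP] := choice (fun w => minimal_proportional w minp u0 pu).
have fE w a : p (w - a *: u) = 0 -> f w = a.
  move=> wa; apply/eqP; rewrite -subr_eq0 -normr_eq0 -[`|_|]mulr1 -pu.
  rewrite -(MseminormZ Mp) eq_le Mseminorm_ge0// andbT.
  have -> : (f w - a) *: u = (w - a *: u) + (- 1) *: (w - f w *: u).
    by rewrite scaleN1r opprB scalerBl [RHS]addrC [RHS]addrA subrK.
  by apply: le_trans (MseminormD Mp _ _) _; rewrite (MseminormZ Mp) wa fP mulr0 addr0.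
have p0 w : p w <= 0 -> p w = 0 by move=> h; apply/eqP; rewrite eq_le h Mseminorm_ge0.
exists f; split.
- split.
  + move=> x y; apply: fE; apply: p0; rewrite scalerDl opprD addrACA.
    by apply: le_trans (MseminormD Mp _ _) _; rewrite !fP addr0.
  + by move=> a x; apply: fE; rewrite -scalerA -scalerBr (MseminormZ Mp) fP mulr0.
  + move=> x y; apply: fE; apply: p0.
    have -> : Num.max (f x) (f y) *: u = Order.join (f x *: u) (f y *: u).
      have [xy|yx] := leP (f x) (f y).
        by apply/esym/join_idPr; rewrite -rsubr_ge0 -scalerBl rscale_ge0// subr_ge0.
      by apply/esym/join_idPl; rewrite -rsubr_ge0 -scalerBl rscale_ge0// subr_ge0 ltW.
    rewrite -(Mseminorm_modulus Mp).
    apply: le_trans (Mseminorm_le Mp (modulus_ge0 _) (modulus_joinB _ _ _ _)) _.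
    by apply: le_trans (MseminormD Mp _ _) _; rewrite !(Mseminorm_modulus Mp) !fP addr0.
- move=> x; apply: le_trans (pN x); apply: le_trans (ler_norm _) _.
  rewrite -[`|_|]mulr1 -pu -(MseminormZ Mp).
  have -> : f x *: u = x + (- 1) *: (x - f x *: u).
    by rewrite scaleN1r opprB addrC subrK.
  by apply: le_trans (MseminormD Mp _ _) _; rewrite (MseminormZ Mp) fP mulr0 addr0.
- by apply: fE; rewrite scale1r subrr Mseminorm0.
Qed.

Lemma exists_lattice_hom N u : Mseminorm N -> 0 <= u -> 0 < N u ->
  exists f, [/\ lattice_hom f, forall x, f x <= N x & f u = N u].
Proof.
move=> MN u0 Nu0.
have v0 : 0 <= (N u)^-1 *: u by rewrite rscale_ge0// invr_ge0 ltW.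
have Nv : N ((N u)^-1 *: u) = 1.
  by rewrite (MseminormZp MN) ?invr_ge0 ?ltW// mulVf// gt_eqF.
have [f [hf fN fv]] := exists_lattice_hom1 MN v0 Nv.
exists f; split => //; move: fv; rewrite (lattice_homZ hf).
by move=> /(congr1 (fun t => N u * t)); rewrite mulrA mulfV ?gt_eqF// mul1r mulr1.
Qed.

End LatticeHoms.

(** * Real lattice homomorphisms, unit homomorphisms and their isolation *)

Section HomTheory.
Context (R : realType) (V : rieszType R).
Implicit Types (x y z u v w : V) (a b : R) (f g : V -> R).

Section one_hom.
Variables (f : V -> R) (hf : lattice_hom f).

Lemma lattice_homN x : f (- x) = - f x.
Proof. by rewrite -scaleN1r (lattice_homZ hf) mulN1r. Qed.

Lemma lattice_homB x y : f (x - y) = f x - f y.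
Proof. by rewrite (lattice_homD hf) lattice_homN. Qed.

Lemma lattice_hom0 : f 0 = 0.
Proof. by rewrite -(subrr 0) lattice_homB subrr. Qed.

Lemma lattice_hom_ge0 x : 0 <= x -> 0 <= f x.
Proof.
move=> x0; rewrite -(ppart_id x0) /ppart (lattice_homU hf) lattice_hom0.
by rewrite le_max lexx orbT.
Qed.

Lemma lattice_hom_le x y : x <= y -> f x <= f y.
Proof.
by rewrite -rsubr_ge0 => /lattice_hom_ge0; rewrite lattice_homB subr_ge0.
Qed.

Lemma lattice_homI x y : f (Order.meet x y) = Num.min (f x) (f y).
Proof. by rewrite meetE lattice_homN (lattice_homU hf) !lattice_homN oppr_max !opprK. Qed.

Lemma lattice_hom_modulus x : f (modulus x) = `|f x|.
Proof.
rewrite (lattice_homU hf) lattice_homN; have [x0|x0] := leP 0 (f x).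
  by rewrite ger0_norm//; apply/max_idPl; lra.
by rewrite ltr0_norm//; apply/max_idPr; lra.
Qed.

End one_hom.

Lemma lattice_hom_scale a f : 0 <= a -> lattice_hom f -> lattice_hom (fun x => a * f x).
Proof.
move=> a0 hf; split.
- by move=> x y; rewrite (lattice_homD hf) mulrDr.
- by move=> b x; rewrite (lattice_homZ hf) mulrCA.
- by move=> x y; rewrite (lattice_homU hf) maxr_pMr.
Qed.

(** If the kernel of [g] lies in that of [f], the functionals are proportional. If not, the modulus
    of a vector in the first kernel but not in the second can be normalized to give [y]. *)
Lemma lattice_hom_separate f g : lattice_hom f -> lattice_hom g ->
  (exists a, f = (fun x => a * g x)) \/ exists y, [/\ 0 <= y, f y = 1 & g y = 0].
Proof.
move=> hf hg; have [[v gv fv]|h] := pselect (exists2 v, g v = 0 & f v != 0).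
  right; exists (`|f v|^-1 *: modulus v); split.
  - by rewrite rscale_ge0 ?invr_ge0 ?modulus_ge0.
  - by rewrite (lattice_homZ hf) (lattice_hom_modulus hf) mulVf// normr_eq0.
  - by rewrite (lattice_homZ hg) (lattice_hom_modulus hg) gv normr0 mulr0.
have {}h v : g v = 0 -> f v = 0.
  by move=> gv; apply: contrapT => fv; apply: h; exists v => //; apply/eqP.
left; have [[v gv]|g0] := pselect (exists v, g v != 0); last first.
  exists 0; apply/funext => x; rewrite mul0r; apply: h.
  by apply: contrapT => /eqP gx; apply: g0; exists x.
exists (f v / g v); apply/funext => x.
have : f (x - (g x / g v) *: v) = 0.
  by apply: h; rewrite (lattice_homB hg) (lattice_homZ hg) divfK// subrr.
rewrite (lattice_homB hf) (lattice_homZ hf) => /eqP; rewrite subr_eq0 => /eqP ->.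
by rewrite mulrAC [RHS]mulrAC [f v * _]mulrC.
Qed.

(** The last clause expresses that the dual norm is exactly 1 without introducing that norm: no
    multiple by a factor above 1 stays below [N]. *)
Definition unit_hom (N : V -> R) f := [/\ lattice_hom f, forall x, f x <= N x &
  forall a, (forall x, a * f x <= N x) -> a <= 1].

(** The bound [0 <= r] matters when [f] is the only unit homomorphism: the other condition then
    holds for every real [r]. *)
Definition peak_level (N : V -> R) f : set R := [set r | 0 <= r /\
  exists x, [/\ 0 <= x, f x = 1 & forall g, unit_hom N g -> g <> f -> g x <= r]].

(* How small the other unit homomorphisms can be made on a positive [x] with
   [f x = 1]. *)
Definition isolation (N : V -> R) f : R := inf (peak_level N f).

Section unit_homs.
Variables (N : V -> R) (MN : Mseminorm N).

Lemma unit_hom_norm_le f x : unit_hom N f -> `|f x| <= N x.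
Proof.
by move=> [hf fN _]; rewrite -(lattice_hom_modulus hf) -(Mseminorm_modulus MN).
Qed.

Lemma exists_unit_hom y : 0 < N y -> exists f, unit_hom N f /\ `|f y| = N y.
Proof.
move=> Ny; have Nm : 0 < N (modulus y) by rewrite Mseminorm_modulus.
have [f [hf fN fy]] := exists_lattice_hom MN (modulus_ge0 y) Nm.
exists f; split; last by rewrite -lattice_hom_modulus// fy Mseminorm_modulus.
split => // a /(_ (modulus y)); rewrite fy.
by rewrite -ler_pdivlMr// mulfV// gt_eqF.
Qed.

Lemma unit_hom_neq0 f : unit_hom N f -> exists2 x, 0 <= x & 0 < f x.
Proof.
move=> [hf fN f1]; apply: contrapT => h.
have f0 x : f x <= 0.
  rewrite leNgt; apply/negP => fx; apply: h; exists (ppart x); first exact: ppart_ge0.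
  by apply: lt_le_trans fx _; apply: lattice_hom_le => //; exact: le_ppart.
have : (2 : R) <= 1.
  by apply: f1 => x; apply: le_trans (Mseminorm_ge0 MN x); have := f0 x; lra.
lra.
Qed.

Lemma unit_hom_proportional f g a : unit_hom N f -> unit_hom N g ->
  f = (fun x => a * g x) -> f = g.
Proof.
move=> uf ug fE; have [x x0 fx] := unit_hom_neq0 uf.
have [hf fN f1] := uf; have [hg gN g1] := ug.
have gx : 0 <= g x by exact: lattice_hom_ge0.
have a0 : 0 < a.
  rewrite ltNge; apply/negP => a0; move: fx; rewrite fE.
  by apply/negP; rewrite -leNgt mulr_le0_ge0.
have a1 : a <= 1 by apply: g1 => z; move: (fN z); rewrite fE.
have a1' : a^-1 <= 1.
  by apply: f1 => z; rewrite fE mulrA mulVf ?gt_eqF// mul1r.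
have a1E : a = 1 by apply/eqP; rewrite eq_le a1 -invf_le1.
by rewrite fE a1E; apply/funext => z; rewrite mul1r.
Qed.

Lemma unit_hom_separate f g : unit_hom N f -> unit_hom N g -> f <> g ->
  exists y, [/\ 0 <= y, f y = 1 & g y = 0].
Proof.
move=> uf ug fg; have [hf _ _] := uf; have [hg _ _] := ug.
have [[a fE]|//] := lattice_hom_separate hf hg.
by case: fg; exact: unit_hom_proportional fE.
Qed.

(** If all positive [x] with [f x = 1] had norm above [1 + e], then [(1 + e) f] would still be
    dominated by [N]. *)
Lemma unit_hom_approx f e : unit_hom N f -> 0 < e ->
  exists x, [/\ 0 <= x, f x = 1 & N x <= 1 + e].
Proof.
move=> [hf fN f1] e0; apply: contrapT => h.
suff : 1 + e <= 1 by lra.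
apply: f1 => x; have [fx|fx] := leP (f x) 0.
  apply: le_trans (Mseminorm_ge0 MN x); rewrite mulr_ge0_le0//; lra.
rewrite leNgt; apply/negP => Nx; apply: h.
exists ((f x)^-1 *: modulus x); split.
- by rewrite rscale_ge0 ?modulus_ge0// invr_ge0 ltW.
- by rewrite (lattice_homZ hf) lattice_hom_modulus// gtr0_norm// mulVf// gt_eqF.
- rewrite (MseminormZp MN) ?invr_ge0 ?(ltW fx)// Mseminorm_modulus//.
  by rewrite ler_pdivrMl// mulrC ltW.
Qed.

(** The factor [t] is the supremum of all admissible factors; a vector where [f] is positive bounds
    them. *)
Lemma exists_unit_scale f a : lattice_hom f -> 0 < a -> (forall x, a * f x <= N x) ->
  (exists x, f x != 0) -> exists2 t, 0 < t & unit_hom N (fun x => t * f x).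
Proof.
move=> hf a0 fN [v fv].
pose S := [set s : R | forall x, s * f x <= N x].
have fv0 : 0 < f (modulus v) by rewrite lattice_hom_modulus// normr_gt0.
have ubS y : 0 < f y -> ubound S (N y / f y).
  by move=> fy s Ss; rewrite ler_pdivlMr.
have S0 : S !=set0 by exists a.
have supa : a <= sup S.
  by apply: ub_le_sup => //; exists (N (modulus v) / f (modulus v)); exact: ubS.
have t0 : 0 < sup S by exact: lt_le_trans supa.
exists (sup S) => //; split; first exact: lattice_hom_scale (ltW _) _.
  move=> x; have [fx|fx] := leP (f x) 0.
    by apply: le_trans (Mseminorm_ge0 MN x); rewrite mulr_ge0_le0// ltW.
  by rewrite -ler_pdivlMr//; apply: ge_sup => //; exact: ubS.
move=> b bN; rewrite -(ler_pM2r t0) mul1r.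
apply: ub_le_sup; first by exists (N (modulus v) / f (modulus v)); exact: ubS.
by move=> x; rewrite -mulrA.
Qed.

Lemma lbound_peak_level f : lbound (peak_level N f) 0.
Proof. by move=> r []. Qed.

Lemma isolation_le f r : peak_level N f r -> isolation N f <= r.
Proof. by apply: ge_inf; exists 0; exact: lbound_peak_level. Qed.

Lemma peak_level_neq0 f : unit_hom N f -> peak_level N f !=set0.
Proof.
move=> uf; have [x [x0 fx Nx]] := unit_hom_approx uf ltr01.
exists (1 + 1); split => //; exists x; split => // g [_ gN _] _.
exact: le_trans (gN x) _.
Qed.

Lemma isolation_ge0 f : unit_hom N f -> 0 <= isolation N f.
Proof.
move=> uf; apply: lb_le_inf; [exact: peak_level_neq0|exact: lbound_peak_level].
Qed.

Lemma isolation_le1 f : unit_hom N f -> isolation N f <= 1.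
Proof.
move=> uf; apply/ler_addgt0Pr => e e0.
have [x [x0 fx Nx]] := unit_hom_approx uf e0.
apply: isolation_le; split; first by lra.
by exists x; split => // g [_ gN _] _; exact: le_trans (gN x) _.
Qed.

Lemma isolation_lt f r : unit_hom N f -> isolation N f < r ->
  exists2 s, s < r & peak_level N f s.
Proof.
move=> uf /(inf_lt (peak_level_neq0 uf))[s fs sr]; by exists s.
Qed.

Hypothesis N_eq0 : forall x, N x = 0 -> x = 0.

(** Some unit homomorphism norms the positive part of [x - y], but by hypothesis all of them vanish
    there. *)
Lemma unit_homs_le x y : (forall f, unit_hom N f -> f x <= f y) -> x <= y.
Proof.
move=> h; have [N0|] := eqVneq (N (ppart (x - y))) 0.
  rewrite -rsubr_ge0 -opprB -[0]oppr0 rleN2.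
  by apply: le_trans (le_ppart _) _; rewrite (N_eq0 N0).
move=> N0; have Npos : 0 < N (ppart (x - y)).
  by rewrite lt_neqAle eq_sym N0 Mseminorm_ge0.
have [f [uf fE]] := exists_unit_hom Npos.
have [hf _ _] := uf.
suff fxy : f (ppart (x - y)) = 0 by move: Npos; rewrite -fE fxy normr0 ltxx.
rewrite /ppart (lattice_homU hf) (lattice_homB hf) (lattice_hom0 hf).
by apply/max_idPr; have := h _ uf; lra.
Qed.

Lemma unit_homs_eq x y : (forall f, unit_hom N f -> f x = f y) -> x = y.
Proof.
by move=> h; apply/eqP; rewrite eq_le !unit_homs_le// => f uf; rewrite h.
Qed.

Lemma norm_le_unit_homs x a : 0 <= a -> (forall f, unit_hom N f -> `|f x| <= a) -> N x <= a.
Proof.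
move=> a0 h; have [N0|N0] := leP (N x) 0; first exact: le_trans a0.
by have [f [uf <-]] := exists_unit_hom N0; exact: h.
Qed.

End unit_homs.
End HomTheory.

(** * Pointwise suprema of bounded families *)

Section PointwiseSup.
Context (R : realType) (V : rieszType R).
Implicit Types (x y : V) (a b : R) (p q : V -> R).

Definition psup (F : set (V -> R)) x : R := sup [set p x | p in F].

Variable F : set (V -> R).
Hypotheses (F0 : F !=set0) (Fub : forall x, has_ubound [set p x | p in F]).

Lemma psup_ge p x : F p -> p x <= psup F x.
Proof. by move=> Fp; apply: ub_le_sup => //; exists p. Qed.

Lemma psup_le x a : (forall p, F p -> p x <= a) -> psup F x <= a.
Proof.
move=> h; apply: ge_sup; first by case: F0 => p Fp; exists (p x), p.
by move=> _ [p Fp <-]; exact: h.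
Qed.

Lemma psupD : (forall p, F p -> forall x y, p (x + y) <= p x + p y) ->
  forall x y, psup F (x + y) <= psup F x + psup F y.
Proof.
move=> FD x y; apply: psup_le => p Fp; apply: le_trans (FD _ Fp _ _) _.
by rewrite lerD// psup_ge.
Qed.

Lemma psupZ : (forall p, F p -> forall a x, p (a *: x) = `|a| * p x) ->
  forall a x, psup F (a *: x) = `|a| * psup F x.
Proof.
move=> FZ.
have le a x : psup F (a *: x) <= `|a| * psup F x.
  by apply: psup_le => p Fp; rewrite FZ// ler_wpM2l// psup_ge.
move=> a x; apply/eqP; rewrite eq_le le /=.
have [->|a0] := eqVneq a 0.
  rewrite normr0 mul0r; case: F0 => p Fp; apply: le_trans (psup_ge _ Fp).
  by rewrite FZ// normr0 mul0r.
have := le a^-1 (a *: x); rewrite scalerA mulVf// scale1r normfV.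
by rewrite ler_pdivlMl ?normr_gt0.
Qed.

Lemma psup_mono :
  (forall p, F p -> forall x y, modulus x <= modulus y -> p x <= p y) ->
  forall x y, modulus x <= modulus y -> psup F x <= psup F y.
Proof.
move=> Fm x y xy; apply: psup_le => p Fp.
by apply: le_trans (Fm _ Fp _ _ xy) _; exact: psup_ge.
Qed.

Lemma psupU :
  (forall p, F p -> forall x y, 0 <= x -> 0 <= y ->
    p (Order.join x y) <= Num.max (p x) (p y)) ->
  forall x y, 0 <= x -> 0 <= y ->
    psup F (Order.join x y) <= Num.max (psup F x) (psup F y).
Proof.
move=> FU x y x0 y0; apply: psup_le => p Fp.
apply: le_trans (FU _ Fp _ _ x0 y0) _.
by rewrite ge_max !le_max !psup_ge// orbT.
Qed.

End PointwiseSup.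

(** * The weighted norm, its unit homomorphisms and their isolation *)

Section WeightedNorm.
Context (R : realType) (V : rieszType R).
Implicit Types (x y : V) (a b d : R) (f g : V -> R).
Variables (N : V -> R) (MN : Mseminorm N).
Variables (Phi : set (V -> R)) (k : (V -> R) -> nat) (theta : R).
Hypotheses (Phi_unit : Phi `<=` unit_hom N) (k_inj : set_inj Phi k).
Hypothesis (theta_gt0 : 0 < theta).

Definition weight f : R := if f \in Phi then 1 + theta / (k f).+1%:R else 1.

(** The zero function keeps the family nonempty even if there is no unit homomorphism. *)
Definition weighted_family : set (V -> R) :=
  (fun=> 0) |` [set (fun x => weight f * `|f x|) | f in unit_hom N].

Definition weighted_norm : V -> R := psup weighted_family.

Lemma weight_in f : Phi f -> weight f = 1 + theta / (k f).+1%:R.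
Proof. by rewrite /weight => /mem_set ->. Qed.

Lemma weight_notin f : ~ Phi f -> weight f = 1.
Proof. by move=> nf; rewrite /weight memNset. Qed.

Lemma weight_ge1 f : 1 <= weight f.
Proof. by rewrite /weight; case: ifP => // _; rewrite lerDl divr_ge0// ltW. Qed.

Lemma weight_gt0 f : 0 < weight f.
Proof. exact: lt_le_trans (weight_ge1 f). Qed.

Lemma weight_ge0 f : 0 <= weight f. Proof. exact/ltW/weight_gt0. Qed.

Lemma weight_le f : weight f <= 1 + theta.
Proof.
rewrite /weight; case: ifP => _; last by rewrite lerDl ltW.
rewrite lerD2l ler_pdivrMr ?ltr0n// ler_peMr ?(ltW theta_gt0)//.
by rewrite ler1n.
Qed.

Let F0 : weighted_family !=set0. Proof. by exists (fun=> 0); left. Qed.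

Let weighted_le p x : weighted_family p -> p x <= (1 + theta) * N x.
Proof.
move=> [->|[f uf <-]].
  by rewrite mulr_ge0 ?Mseminorm_ge0// addr_ge0// ltW.
by apply: ler_pM => //; [exact: weight_ge0|exact: weight_le|exact: unit_hom_norm_le].
Qed.

Let Fub x : has_ubound [set p x | p in weighted_family].
Proof. by exists ((1 + theta) * N x) => _ [p Fp <-]; exact: weighted_le. Qed.

Lemma weighted_norm_le x : weighted_norm x <= (1 + theta) * N x.
Proof. by apply: psup_le => // p; exact: weighted_le. Qed.

Lemma weighted_norm_hom f x : unit_hom N f -> weight f * `|f x| <= weighted_norm x.
Proof.
move=> uf; apply: (@psup_ge _ _ _ Fub (fun x => weight f * `|f x|)).
by right; exists f.
Qed.

Lemma weighted_norm_leP x a : 0 <= a ->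
  (forall f, unit_hom N f -> weight f * `|f x| <= a) -> weighted_norm x <= a.
Proof. by move=> a0 h; apply: psup_le => // p [->//|[f uf <-]]; exact: h. Qed.

Lemma weighted_norm_ge x : N x <= weighted_norm x.
Proof.
have w0 : 0 <= weighted_norm x by apply: (@psup_ge _ _ _ Fub (fun=> 0)); left.
apply: norm_le_unit_homs => // f uf; apply: le_trans (weighted_norm_hom x uf).
by rewrite ler_peMl// weight_ge1.
Qed.

Lemma weighted_norm_Mseminorm : Mseminorm weighted_norm.
Proof.
split.
- apply: psupD => // _ [->|[f [hf _ _] <-]] x y; first by rewrite addr0.
  by rewrite (lattice_homD hf) -mulrDr ler_wpM2l ?weight_ge0// ler_normD.
- apply: psupZ => // _ [->|[f [hf _ _] <-]] a x; first by rewrite mulr0.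
  by rewrite (lattice_homZ hf) normrM mulrCA.
- apply: psup_mono => // _ [->//|[f [hf _ _] <-]] x y xy.
  rewrite ler_wpM2l ?weight_ge0// -!lattice_hom_modulus//.
  exact: lattice_hom_le.
- apply: psupU => // _ [->|[f [hf _ _] <-]] x y x0 y0; first by rewrite maxxx.
  rewrite (lattice_homU hf) -maxr_pMr ?weight_ge0// !ger0_norm ?lattice_hom_ge0//.
  by rewrite le_max lattice_hom_ge0.
Qed.

Let MW := weighted_norm_Mseminorm.

(** Since [k] is injective on [Phi], each step of the induction has at most one new [g] to kill;
    this is done by a meet with a vector that separates it from [f]. *)
Lemma kill_finitely_many f n : unit_hom N f -> exists y, [/\ 0 <= y, f y = 1 &
  forall g, Phi g -> g <> f -> (k g < n)%N -> g y = 0].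
Proof.
move=> uf; elim: n => [|n [y [y0 fy yP]]].
  by have [x [x0 fx _]] := unit_hom_approx MN uf ltr01; exists x; split.
have [[g [Phig gf kg]]|h] := pselect (exists g, [/\ Phi g, g <> f & k g = n]).
  have [z [z0 fz gz]] := unit_hom_separate MN uf (Phi_unit Phig) (nesym gf).
  exists (Order.meet y z); have [hf _ _] := uf; split.
  - by rewrite lexI y0.
  - by rewrite (lattice_homI hf) fy fz minxx.
  - move=> g' Phig' g'f; have [hg' _ _] := Phi_unit Phig'.
    rewrite ltnS leq_eqVlt (lattice_homI hg') => /orP[/eqP kg'|kg'].
      have -> : g' = g by apply: k_inj; rewrite ?inE// kg.
      by rewrite gz; apply/min_idPr; apply: lattice_hom_ge0 => //; case: (Phi_unit Phig).
    by rewrite yP//; apply/min_idPl; exact: lattice_hom_ge0.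
exists y; split => // g Phig gf; rewrite ltnS leq_eqVlt => /orP[/eqP kg|]; last exact: yP.
by exfalso; apply: h; exists g.
Qed.

(** Weights above [1 + d] occur only at indices below some [n]. Cutting [x] down by a vector on
    which those finitely many rivals vanish leaves only weights of at most [1 + d]. *)
Lemma localize f x d : unit_hom N f -> 0 <= x -> f x = 1 -> 0 < d ->
  exists x', [/\ 0 <= x', x' <= x, f x' = 1 & forall g, unit_hom N g -> g <> f ->
    weight g * g x' <= (1 + d) * g x].
Proof.
move=> uf x0 fx d0.
pose n := (Num.truncn (theta / d)).+1.
have [y [y0 fy yP]] := kill_finitely_many n uf; have [hf _ _] := uf.
exists (Order.meet x y); split.
- by rewrite lexI x0.
- exact: leIl.
- by rewrite (lattice_homI hf) fx fy minxx.
- move=> g ug gf; have [hg _ _] := ug; rewrite (lattice_homI hg).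
  have gx0 := lattice_hom_ge0 hg x0.
  have [Phig|nPhi] := pselect (Phi g); last first.
    rewrite weight_notin// mul1r; apply: (@le_trans _ _ (g x)).
      by rewrite ge_min lexx.
    by rewrite ler_peMl// lerDl ltW.
  have [kn|nk] := ltnP (k g) n.
    rewrite (yP g)// (_ : Num.min _ _ = 0) ?mulr0 ?mulr_ge0//; last exact/min_idPr.
    by rewrite addr_ge0// ltW.
  apply: (@le_trans _ _ (weight g * g x)).
    by rewrite ler_wpM2l ?weight_ge0// ge_min lexx.
  rewrite ler_wpM2r// weight_in// lerD2l ler_pdivrMr ?ltr0n//.
  rewrite mulrC -ler_pdivrMr//; apply: ltW; apply: lt_le_trans (truncnS_gt _) _.
  by rewrite ler_nat (leq_trans nk).
Qed.

(** For the last clause, localize a nearly norming [x]: the rivals contribute at most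
    [(1 + d) * (1 + d)], so the weighted norm of [x'] is at most [weight f] times this. *)
Lemma unit_hom_weighted f : unit_hom N f ->
  unit_hom weighted_norm (fun x => weight f * f x).
Proof.
move=> uf; have [hf fN _] := uf; split.
- exact: lattice_hom_scale (weight_ge0 f) hf.
- move=> x; apply: le_trans (weighted_norm_hom x uf).
  by rewrite ler_wpM2l ?weight_ge0// ler_norm.
- move=> a aP; apply/ler_addgt0Pr => e e0.
  (* With [d <= 1] the square of [1 + d] is at most [1 + 3 * d], hence at most [1 + e]. *)
  pose d := Num.min 1 (e / 3).
  have d0 : 0 < d by rewrite lt_min ltr01 divr_gt0.
  have [x [x0 fx Nx]] := unit_hom_approx MN uf d0.
  have [x' [x'0 x'x fx' x'P]] := localize uf x0 fx d0.
  have : a * weight f <= weight f * ((1 + d) * (1 + d)).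
    apply: le_trans (_ : a * weight f <= weighted_norm x') _.
      by move: (aP x'); rewrite fx' mulr1.
    have d2 : 1 <= (1 + d) * (1 + d) by nra.
    apply: weighted_norm_leP => [|g ug].
      by rewrite mulr_ge0 ?weight_ge0//; lra.
    have [hg gN _] := ug; rewrite ger0_norm ?lattice_hom_ge0//.
    have [->|gf] := pselect (g = f).
      by rewrite fx' ler_wpM2l ?weight_ge0.
    apply: le_trans (x'P _ ug gf) _.
    have gx : g x <= 1 + d by exact: le_trans (gN x) _.
    have w1 := weight_ge1 f.
    apply: (@le_trans _ _ ((1 + d) * (1 + d))); first by rewrite ler_wpM2l//; lra.
    by rewrite ler_peMl//; lra.
  rewrite [a * _]mulrC ler_pM2l ?weight_gt0// => /le_trans; apply.
  have d1 : d <= 1 by rewrite ge_min lexx.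
  have de : d <= e / 3 by rewrite ge_min lexx orbT.
  nra.
Qed.

(** Some positive multiple [g] of [f] is a unit homomorphism of [N]. Its weighted version is a unit
    homomorphism proportional to [f], hence equal to [f]. *)
Lemma unit_hom_weightedP f : unit_hom weighted_norm f ->
  exists2 g, unit_hom N g & f = (fun x => weight g * g x).
Proof.
move=> uf; have [hf fN _] := uf.
have [x _ fx] := unit_hom_neq0 MW uf.
have t0 : 0 < 1 + theta by rewrite addr_gt0.
have [t t_gt0 ug] : exists2 t, 0 < t & unit_hom N (fun x => t * f x).
  apply: (@exists_unit_scale _ _ _ MN _ (1 + theta)^-1) => //.
  - by rewrite invr_gt0.
  - move=> y; rewrite ler_pdivrMl//; apply: le_trans (fN y) _.
    exact: weighted_norm_le.
  - by exists x; rewrite gt_eqF.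
exists (fun x => t * f x) => //.
apply: (@unit_hom_proportional _ _ _ MW _ _ (weight (fun x => t * f x) * t)^-1) => //.
  exact: unit_hom_weighted.
apply/funext => y; rewrite [weight _ * (_ * _)]mulrA mulKf//.
by rewrite mulf_neq0 ?gt_eqF// weight_gt0.
Qed.

(** Normalizing a peak for the weighted [f] divides by [weight f]. For one inequality the peak is
    first localized, so that the rivals' weights cost only a factor [1 + d]; for the other, weights
    of at least 1 only enlarge the rivals. *)
Lemma isolation_weighted f : unit_hom N f ->
  isolation weighted_norm (fun x => weight f * f x) = isolation N f / weight f.
Proof.
move=> uf; have wf := weight_gt0 f; have uwf := unit_hom_weighted uf.
have [hf _ _] := uf.
apply/eqP; rewrite eq_le; apply/andP; split.
  rewrite ler_pdivlMr//; apply: lb_le_inf; first exact: peak_level_neq0 uf.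
  move=> r [r0 [x [x0 fx xP]]]; rewrite -ler_pdivlMr//.
  apply/ler_addgt0Pr => e e0.
  (* This gives [d * r <= e]; adding 1 covers [r = 0]. *)
  pose d := e / (r + 1).
  have d0 : 0 < d by rewrite divr_gt0//; lra.
  have [x' [x'0 x'x fx' x'P]] := localize uf x0 fx d0.
  apply: (@le_trans _ _ ((1 + d) * r / weight f)); last first.
    rewrite ler_pdivrMr// mulrDl mul1r [X in _ <= X]mulrDl divfK ?gt_eqF// lerD2l.
    apply: (@le_trans _ _ e); last by rewrite ler_peMr ?(ltW e0)// weight_ge1.
    by rewrite /d mulrAC ler_pdivrMr ?ler_pM2l//; lra.
  apply: isolation_le; split.
    by rewrite divr_ge0 ?mulr_ge0 ?(ltW wf)//; lra.
  exists ((weight f)^-1 *: x'); split.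
  - by rewrite rscale_ge0// invr_ge0 ltW.
  - by rewrite (lattice_homZ hf) fx' mulr1 mulfV// gt_eqF.
  - move=> _ /unit_hom_weightedP[g ug ->] gf; have [hg _ _] := ug.
    have {}gf : g <> f by move=> gE; apply: gf; rewrite gE.
    rewrite (lattice_homZ hg) mulrCA mulrC ler_wpM2r ?invr_ge0 ?(ltW wf)//.
    apply: le_trans (x'P _ ug gf) _; rewrite ler_wpM2l//; last exact: xP.
    lra.
apply: lb_le_inf; first exact: (peak_level_neq0 MW).
move=> r [r0 [x [x0 fx xP]]]; rewrite ler_pdivrMr//.
apply: isolation_le; split; first by rewrite mulr_ge0// ltW.
exists (weight f *: x); split.
- by rewrite rscale_ge0// ltW.
- by rewrite (lattice_homZ hf).
- move=> g ug gf; have [hg _ _] := ug; rewrite (lattice_homZ hg) mulrC.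
  rewrite ler_wpM2r ?(ltW wf)//.
  apply: (@le_trans _ _ (weight g * g x)).
    by rewrite ler_peMl ?weight_ge1// lattice_hom_ge0.
  apply: (xP (fun x => weight g * g x)); first exact: unit_hom_weighted.
  move=> E; apply: gf; apply: (@unit_hom_proportional _ _ _ MN _ _ ((weight g)^-1 * weight f)) => //.
  apply/funext => z; rewrite -mulrA -(congr1 (fun h => h z) E) /= mulKf//.
  by rewrite gt_eqF// weight_gt0.
Qed.

End WeightedNorm.

(** * Homomorphisms that do not vanish at an atom *)

Section Atoms.
Context (R : realType) (V : rieszType R).
Implicit Types (x y e : V) (a b : R) (f g : V -> R).

(** For [x >= 0] the meet of [x] with [n *: e] is a multiple of [e], where [f] and [g] agree. As [n]
    exceeds both [f x] and [g x], the values there are [f x] and [g x] themselves. *)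
Lemma atom_hom_unique e f g : atom e -> lattice_hom f -> lattice_hom g ->
  f e = 1 -> g e = 1 -> f = g.
Proof.
move=> [e0 eP] hf hg fe ge.
have pos x : 0 <= x -> f x = g x.
  move=> x0; pose n := 1 + f x + g x.
  have fx := lattice_hom_ge0 hf x0; have gx := lattice_hom_ge0 hg x0.
  have n0 : 0 < n by rewrite /n; lra.
  have ne0 : 0 <= n *: e by rewrite rscale_ge0// ltW.
  have [|a aE] := eP (n^-1 *: Order.meet x (n *: e)).
    apply/andP; split; first by rewrite rscale_ge0 ?invr_ge0 ?(ltW n0)// lexI x0.
    rewrite -{2}[e]scale1r -[1](mulVf (lt0r_neq0 n0)) -scalerA.
    by rewrite rleZ2l ?invr_ge0 ?(ltW n0)// leIr.
  have fE : f (n^-1 *: Order.meet x (n *: e)) = a by rewrite aE (lattice_homZ hf) fe mulr1.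
  have gE : g (n^-1 *: Order.meet x (n *: e)) = a by rewrite aE (lattice_homZ hg) ge mulr1.
  move: fE; rewrite -gE (lattice_homZ hf) (lattice_homZ hg) (lattice_homI hf) (lattice_homI hg).
  rewrite (lattice_homZ hf) (lattice_homZ hg) fe ge mulr1.
  move=> /(mulfI (invr_neq0 (lt0r_neq0 n0))).
  by rewrite !min_l// /n; lra.
apply/funext => x; rewrite -(ppart_sub x) (lattice_homB hf) (lattice_homB hg).
by rewrite !pos ?ppart_ge0.
Qed.

Variables (N : V -> R) (MN : Mseminorm N).

Lemma atom_unit_hom_unique e f g : atom e -> unit_hom N f -> unit_hom N g ->
  f e != 0 -> g e != 0 -> f = g.
Proof.
move=> ate uf ug fe ge; have [hf _ _] := uf; have [hg _ _] := ug.
have e0 : 0 <= e by apply: ltW; case: ate.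
apply: (@unit_hom_proportional _ _ _ MN _ _ (f e / g e)) => //.
have := atom_hom_unique ate
  (lattice_hom_scale (a := (f e)^-1) _ hf) (lattice_hom_scale (a := (g e)^-1) _ hg).
rewrite !invr_ge0 !lattice_hom_ge0// !mulVf// => /(_ isT isT erefl erefl) E.
apply/funext => x; have /(congr1 (fun t => f e * t)) := congr1 (fun h => h x) E.
by rewrite /= mulrA mulfV// mul1r => ->; rewrite mulrA.
Qed.

Lemma isolation_atom e f : atom e -> unit_hom N f -> f e != 0 -> isolation N f = 0.
Proof.
move=> ate uf fe; have [hf _ _] := uf.
have e0 : 0 <= e by apply: ltW; case: ate.
apply/eqP; rewrite eq_le (isolation_ge0 MN uf) andbT; apply: isolation_le; split => //.
exists ((f e)^-1 *: e); split.
- by rewrite rscale_ge0 ?invr_ge0 ?lattice_hom_ge0.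
- by rewrite (lattice_homZ hf) mulVf.
- move=> g ug gf; have [hg _ _] := ug.
  suff ge : g e = 0 by rewrite (lattice_homZ hg) ge mulr0.
  by apply: contrapT => /eqP ge; apply: gf; exact: atom_unit_hom_unique ate _ _ _ _.
Qed.

End Atoms.

(** * Consequences of completeness and of separability *)

Section BanachLatticeAtoms.
Context (R : realType) (X : banachLatticeType R) (AMX : AM_space X).
Implicit Types (x y e : X) (a b : R) (f g : X -> R).

Let nrm : X -> R := fun x => `|x|.

Lemma AM_space_Mseminorm : Mseminorm (fun x : X => `|x|).
Proof.
case: AMX => -[[nD nZ _] nm] nU; split => //.
by move=> x y x0 y0; rewrite nU.
Qed.

Let MN := AM_space_Mseminorm.

(** Peaks [u n] with rivals below [1 / (n + 1)] form a Cauchy sequence, because unit homomorphisms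
    compute the norm. All rivals vanish at its limit [e], so they cannot tell [x] between 0 and [e]
    from [f x *: e]. *)
Lemma isolation_eq0_atom f : unit_hom nrm f -> isolation nrm f = 0 ->
  exists2 e : X, atom e & f e = 1.
Proof.
move=> uf f0; have [hf fN _] := uf.
have /choice[u uP] n : exists x : X, [/\ 0 <= x, f x = 1 &
    forall g, unit_hom nrm g -> g <> f -> g x <= n.+1%:R^-1].
  have [s sn [_ [x [x0 fx xP]]]] : exists2 s, s < n.+1%:R^-1 & peak_level nrm f s.
    by apply: (isolation_lt MN) => //; rewrite f0 invr_gt0 ltr0n.
  by exists x; split => // g ug gf; exact: le_trans (xP _ ug gf) (ltW sn).
have inv_small (d : R) : 0 < d -> exists n : nat, forall m, (n <= m)%N -> m.+1%:R^-1 < d.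
  move=> d0; have [n] := ltr_add_invr d0; rewrite add0r => nd; exists n => m nm.
  by apply: le_lt_trans nd; rewrite lef_pV2 ?posrE ?ltr0n// ler_nat.
have dist (n m : nat) : (n <= m)%N -> `|u n - u m| <= n.+1%:R^-1.
  move=> nm; apply: (norm_le_unit_homs MN); first by rewrite invr_ge0.
  move=> g ug; have [hg _ _] := ug; rewrite (lattice_homB hg).
  have [un0 fun1 unP] := uP n; have [um0 fum1 umP] := uP m.
  have [->|gf] := pselect (g = f); first by rewrite fun1 fum1 subrr normr0 invr_ge0.
  have le_nm : m.+1%:R^-1 <= n.+1%:R^-1 :> R by rewrite lef_pV2 ?posrE ?ltr0n// ler_nat.
  have gn := unP _ ug gf; have gm := le_trans (umP _ ug gf) le_nm.
  have gn0 := lattice_hom_ge0 hg un0; have gm0 := lattice_hom_ge0 hg um0.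
  move: (n.+1%:R^-1) (g (u n)) (g (u m)) gn gm gn0 gm0 => c p q gn gm gn0 gm0.
  by rewrite ler_norml; apply/andP; split; lra.
have /cauchy_cvg/cvg_ex[/= e ue] : cauchy (u @ \oo).
  apply: cauchy_exP => d d0; have [n nP] := inv_small _ d0.
  exists (u n); exists n => // m nm.
  by rewrite -ball_normE /=; exact: le_lt_trans (dist n m nm) (nP n (leqnn n)).
have close (d : R) : 0 < d -> exists n, n.+1%:R^-1 < d /\ `|e - u n| < d.
  move=> d0; have [n nP] := inv_small _ d0.
  have /cvgr_dist_lt/(_ d d0)[m _ mP] := ue.
  exists (maxn n m); split; first by apply: nP; rewrite leq_maxl.
  by apply: mP => /=; rewrite leq_maxr.
have fe : f e = 1.
  apply/eqP; rewrite -subr_eq0 -normr_le0; apply/ler_addgt0Pr => d d0.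
  have [n [_ en]] := close _ d0; have [_ fun1 _] := uP n.
  rewrite add0r -fun1 -(lattice_homB hf).
  exact: le_trans (unit_hom_norm_le MN _ uf) (ltW en).
have ge g : unit_hom nrm g -> g <> f -> g e = 0.
  move=> ug gf; have [hg _ _] := ug.
  apply/eqP; rewrite -normr_le0; apply/ler_addgt0Pr => d d0.
  have d20 : 0 < d / 2 by rewrite divr_gt0.
  have [n [nd en]] := close _ d20; have [un0 _ unP] := uP n.
  have gu := unP _ ug gf; have gu0 := lattice_hom_ge0 hg un0.
  have := le_trans (unit_hom_norm_le MN (e - u n) ug) (ltW en).
  rewrite (lattice_homB hg) !ler_norml add0r => /andP[].
  move: (g e) (g (u n)) (n.+1%:R^-1) nd gu gu0 => p q r nd gu gu0 h1 h2.
  by apply/andP; split; lra.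
have N0 (x : X) : `|x| = 0 -> x = 0 by exact: normr0_eq0.
exists e => //; split.
  rewrite lt_neqAle; apply/andP; split.
    by apply/eqP => e0; move: fe; rewrite -e0 (lattice_hom0 hf) => /esym/eqP; rewrite oner_eq0.
  apply: (unit_homs_le MN N0) => g ug; have [hg _ _] := ug; rewrite (lattice_hom0 hg).
  by have [->|gf] := pselect (g = f); [rewrite fe|rewrite ge].
move=> x /andP[x0 xe]; exists (f x).
apply: (unit_homs_eq MN N0) => g ug; have [hg _ _] := ug; rewrite (lattice_homZ hg).
have [->|gf] := pselect (g = f); first by rewrite fe mulr1.
rewrite ge// mulr0; apply/eqP; rewrite eq_le lattice_hom_ge0// andbT -(ge g)//.
exact: lattice_hom_le.
Qed.

Hypothesis sepX : separable_space X.

Lemma dense_sequence : exists d : nat -> X, forall x a, 0 < a -> exists n, `|x - d n| < a.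
Proof.
case: sepX => D /countable_injP[h hinj] dD.
(* The sequence inverts the enumeration [h]; indices that [h] misses are sent to 0. *)
exists (fun n => xget 0 [set y | D y /\ h y = n]) => x a a0.
have [|y [/= xy Dy]] := dD (ball x a) _ (ball_open _ _).
  by exists x; exact: ballxx.
exists (h y); case: xgetP => [z _ [Dz hz]|/(_ y)]; last by move=> /(_ (conj Dy erefl)).
have -> : z = y by apply: hinj; rewrite ?inE.
by move: xy; rewrite -ball_normE.
Qed.

(** [Phi] collects, for each member of a dense sequence, a unit homomorphism norming it (for
    separation) and the at most one that exceeds 1 there while the others stay below 1 (for
    isolation below 1). The tag and the index determine the homomorphism, which gives the
    injection. *)
Lemma separating_countable_unit_homs : exists Phi : set (X -> R),
  [/\ Phi `<=` unit_hom nrm,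
      exists k : (X -> R) -> nat, set_inj Phi k,
      forall f, unit_hom nrm f -> isolation nrm f < 1 -> Phi f &
      forall x, x != 0 -> exists2 f, Phi f & f x != 0].
Proof.
have [d dP] := dense_sequence.
have /choice[F FP] n : exists f, d n != 0 -> unit_hom nrm f /\ `|f (d n)| = `|d n|.
  have [->|dn] := eqVneq (d n) 0; first by exists (fun=> 0) => /eqP.
  have dn0 : 0 < `|d n| by rewrite normr_gt0.
  by have [f fP] := exists_unit_hom MN dn0; exists f.
have peak f : unit_hom nrm f -> isolation nrm f < 1 -> exists n, 1 < f (d n) /\
    forall g, unit_hom nrm g -> g <> f -> g (d n) < 1.
  move=> uf; have [hf _ _] := uf.
  move=> /(isolation_lt MN uf)[r r1 [r0 [x [x0 fx xP]]]].
  have s0 : 0 < 1 + r by lra.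
  (* This is the distance from 1 of both [2 / (1 + r)] and [2 / (1 + r) * r]. *)
  have e0 : 0 < (1 - r) / (1 + r) by rewrite divr_gt0//; lra.
  (* The scaling makes [f] larger and all other [g] smaller than [1]. *)
  have [n] := dP ((2 / (1 + r)) *: x) _ e0; move=> dn; exists n.
  have fd g : unit_hom nrm g -> `|2 / (1 + r) * g x - g (d n)| < (1 - r) / (1 + r).
    move=> ug; have [hg _ _] := ug; rewrite -(lattice_homZ hg) -(lattice_homB hg).
    by apply: le_lt_trans dn; exact: (unit_hom_norm_le MN ((2 / (1 + r)) *: x - d n) ug).
  have E : 2 / (1 + r) = 1 + (1 - r) / (1 + r) by field; lra.
  split.
    by have := fd _ uf; rewrite fx mulr1 E ltr_norml => /andP[_]; lra.
  move=> g ug gf; have := fd _ ug; have := xP _ ug gf => gr.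
  have : 2 / (1 + r) * g x <= 2 / (1 + r) * r by rewrite ler_wpM2l// divr_ge0//; lra.
  have -> : 2 / (1 + r) * r = 1 - (1 - r) / (1 + r) by field; lra.
  by rewrite ltr_norml => h /andP[h' _]; lra.
pose P f (m : nat + nat) := match m with
  | inl n => f = F n
  | inr n => 1 < f (d n) /\ forall g, unit_hom nrm g -> g <> f -> g (d n) < 1 end.
pose Phi := [set f | unit_hom nrm f /\ exists m, P f m].
have /choice[k kP] f : exists m, Phi f -> P f m.
  by have [[_ [m Pm]]|nPhi] := pselect (Phi f); [exists m|exists (inl 0%N)].
exists Phi; split.
- by move=> f [].
- exists (fun f => choice.pickle (k f)) => f g.
  rewrite !inE => Phif Phig /(pcan_inj choice.pickleK) kfg.
  have := kP _ Phif; have := kP _ Phig; rewrite -kfg; case: (k f) => n /=.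
    by move=> -> ->.
  move=> [g1 _] [_ fP]; apply: contrapT => fg.
  have [ug _] := Phig.
  by have := fP _ ug (nesym fg); lra.
- move=> f uf f1; split => //; have [n nP] := peak _ uf f1.
  by exists (inr n).
- move=> x x0; have x4 : 0 < `|x| / 2 by rewrite divr_gt0// normr_gt0.
  have [n dn] := dP x _ x4.
  have dxn : `|x| / 2 < `|d n|.
    have := ler_distD (d n) x 0; rewrite !subr0; lra.
  have dn0 : d n != 0 by rewrite -normr_gt0; lra.
  have [uF FE] := FP _ dn0; exists (F n); first by split => //; exists (inl n).
  apply/eqP => Fx; have [hF _ _] := uF.
  have := unit_hom_norm_le MN (x - d n) uF; rewrite (lattice_homB hF) Fx sub0r normrN FE.
  rewrite /nrm; lra.
Qed.

End BanachLatticeAtoms.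

(** * Lattice isometries and what they preserve *)

Section Automorphisms.
Context (R : realType) (V : rieszType R).
Implicit Types (x y e : V) (a b : R) (f g : V -> R) (S T : V -> V).

(** [T] is a bare function, so that an inverse obtained by choice can be treated in the same way. *)
Record norm_automorphism (N : V -> R) T : Prop := {
  automorphismD : forall x y, T (x + y) = T x + T y;
  automorphismZ : forall a x, T (a *: x) = a *: T x;
  automorphismU : forall x y, T (Order.join x y) = Order.join (T x) (T y);
  automorphism_norm : forall x, N (T x) = N x;
  automorphism_surj : forall y, exists x, T x = y }.

Section one_automorphism.
Variables (N : V -> R) (T : V -> V) (AT : norm_automorphism N T).

Lemma automorphism0 : T 0 = 0.
Proof. by rewrite -[in LHS](scale0r 0) (automorphismZ AT) scale0r. Qed.

Lemma automorphismN x : T (- x) = - T x.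
Proof. by rewrite -scaleN1r (automorphismZ AT) scaleN1r. Qed.

Lemma automorphismB x y : T (x - y) = T x - T y.
Proof. by rewrite (automorphismD AT) automorphismN. Qed.

Lemma automorphismI x y : T (Order.meet x y) = Order.meet (T x) (T y).
Proof. by rewrite meetE automorphismN (automorphismU AT) !automorphismN -meetE. Qed.

Lemma automorphism_ge0 x : 0 <= x -> 0 <= T x.
Proof.
move=> x0; rewrite -(ppart_id x0) /ppart (automorphismU AT) automorphism0.
exact: leUr.
Qed.

Lemma automorphism_le x y : x <= y -> T x <= T y.
Proof. by rewrite -rsubr_ge0 => /automorphism_ge0; rewrite automorphismB rsubr_ge0. Qed.

Lemma lattice_hom_automorphism f : lattice_hom f -> lattice_hom (f \o T).
Proof.
move=> hf; split => [x y|a x|x y] /=.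
- by rewrite (automorphismD AT) (lattice_homD hf).
- by rewrite (automorphismZ AT) (lattice_homZ hf).
- by rewrite (automorphismU AT) (lattice_homU hf).
Qed.

Lemma unit_hom_automorphism f : unit_hom N f -> unit_hom N (f \o T).
Proof.
move=> [hf fN f1]; split.
- exact: lattice_hom_automorphism.
- by move=> x /=; rewrite -(automorphism_norm AT).
- move=> a aP; apply: f1 => y; have [x <-] := automorphism_surj AT y.
  by rewrite (automorphism_norm AT); exact: aP.
Qed.

Hypotheses (N_0 : N 0 = 0) (N_eq0 : forall x, N x = 0 -> x = 0).

Lemma automorphism_inj : injective T.
Proof.
move=> x y Txy; apply/eqP; rewrite -subr_eq0; apply/eqP/N_eq0.
by rewrite -(automorphism_norm AT) automorphismB Txy subrr.
Qed.

Lemma automorphism_inverse : exists S, [/\ norm_automorphism N S, cancel T S & cancel S T].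
Proof.
have /choice[S TS] := automorphism_surj AT.
have ST : cancel T S by move=> x; apply: automorphism_inj; rewrite TS.
exists S; split => //; split.
- by move=> x y; apply: automorphism_inj; rewrite (automorphismD AT) !TS.
- by move=> a x; apply: automorphism_inj; rewrite (automorphismZ AT) !TS.
- by move=> x y; apply: automorphism_inj; rewrite (automorphismU AT) !TS.
- by move=> x; rewrite -(automorphism_norm AT) TS.
- by move=> y; exists (T y).
Qed.

End one_automorphism.

Section inverse.
Variables (N : V -> R) (T S : V -> V).
Hypotheses (AT : norm_automorphism N T) (AS : norm_automorphism N S).
Hypotheses (ST : cancel T S) (TS : cancel S T).

(** The peak is moved by [S], and each rival [g] of [f \o T] comes from the rival [g \o S] of
    [f]. *)
Lemma peak_level_automorphism f r : peak_level N f r -> peak_level N (f \o T) r.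
Proof.
move=> [r0 [x [x0 fx xP]]]; split => //; exists (S x); split => /=.
- exact: automorphism_ge0 AS _ x0.
- by rewrite TS.
- move=> g ug gf; apply: (xP (g \o S)); first exact: unit_hom_automorphism.
  by move=> E; apply: gf; rewrite -E; apply/funext => y /=; rewrite ST.
Qed.

Lemma atom_automorphism e : atom e -> atom (T e).
Proof.
move=> [e0 eP]; split.
  rewrite lt_neqAle (automorphism_ge0 AT (ltW e0)) andbT.
  apply/eqP => Te; move: e0; rewrite -(ST e) -Te.
  by rewrite (automorphism0 AS) ltxx.
move=> x /andP[x0 xTe].
have [|a aE] := eP (S x).
  apply/andP; split; first exact: (automorphism_ge0 AS).
  by rewrite -(ST e); exact: (automorphism_le AS).
by exists a; rewrite -(TS x) aE (automorphismZ AT).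
Qed.

End inverse.

Lemma isolation_automorphism N T S f :
  norm_automorphism N T -> norm_automorphism N S -> cancel T S -> cancel S T ->
  isolation N (f \o T) = isolation N f.
Proof.
move=> AT AS ST TS; congr inf; apply/seteqP; split => r; last first.
  exact: (peak_level_automorphism AS ST TS).
move=> /(peak_level_automorphism AT TS ST).
by rewrite (_ : (f \o T) \o S = f)//; apply/funext => x /=; rewrite TS.
Qed.

(** The meet is a multiple of both atoms; if it is nonzero, they are multiples of each other. *)
Lemma atoms_proportional_or_disjoint e e' : atom e -> atom e' ->
  (exists2 a, 0 < a & e' = a *: e) \/ Order.meet e e' = 0.
Proof.
move=> [e0 eP] [e'0 e'P].
have m0 : 0 <= Order.meet e e' by rewrite lexI !ltW.
have [|a aE] := eP (Order.meet e e'); first by rewrite m0 leIl.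
have [|b bE] := e'P (Order.meet e e'); first by rewrite m0 leIr.
have [b0|b0] := eqVneq b 0; first by right; rewrite bE b0 scale0r.
left; have e'E : e' = (b^-1 * a) *: e by rewrite -scalerA -aE bE scalerA mulVf ?scale1r.
exists (b^-1 * a) => //; rewrite ltNge; apply/negP => h.
have : e' <= 0.
  by rewrite e'E -[X in X <= _]opprK -scaleNr -[0]oppr0 rleN2 rscale_ge0 ?oppr_ge0// ltW.
by move=> /(lt_le_trans e'0); rewrite ltxx.
Qed.

End Automorphisms.

(** * The rigid AM-norm for at most one atom *)

Section Renormings.
Context (R : realType) (X : banachLatticeType R) (AMX : AM_space X).
Implicit Types (x y e : X) (a b : R) (f g : X -> R) (T : X -> X).

Let nrm : X -> R := fun x => `|x|.
Let MN : Mseminorm nrm := AM_space_Mseminorm AMX.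
Let nrm_eq0 x : nrm x = 0 -> x = 0. Proof. exact: normr0_eq0. Qed.

Variables (Phi : set (X -> R)) (k : (X -> R) -> nat).
Hypotheses (Phi_unit : Phi `<=` unit_hom nrm) (k_inj : set_inj Phi k).
Hypothesis Phi_isolated : forall f, unit_hom nrm f -> isolation nrm f < 1 -> Phi f.
Hypothesis Phi_separates : forall x, x != 0 -> exists2 f, Phi f & f x != 0.

(** Only these receive a weight above 1; coordinate functionals of atoms have isolation 0 and keep
    weight 1. *)
Definition nonatomic_part : set (X -> R) := [set f | Phi f /\ 0 < isolation nrm f].

Let Phi0 := nonatomic_part.
Let Phi0_unit : Phi0 `<=` unit_hom nrm. Proof. by move=> f [/Phi_unit]. Qed.
Let k_inj0 : set_inj Phi0 k.
Proof. by move=> f g; rewrite !inE => -[Pf _] [Pg _]; apply: k_inj; rewrite inE. Qed.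

(** Cross-multiplied form of the requirement that the weighted isolations of distinct [f] and [g]
    differ. *)
Definition rigid_parameter theta := forall f g, Phi0 f -> Phi0 g -> f <> g ->
  isolation nrm f * (1 + theta / (k g).+1%:R) != isolation nrm g * (1 + theta / (k f).+1%:R).

(* For each pair [(f, g)] the condition is affine in [theta]; if two values
   violated it, then [isolation f = isolation g] and [k f = k g]. *)
Lemma exists_rigid_parameter a : 0 < a -> exists theta, [/\ 0 < theta, theta < a &
  rigid_parameter theta].
Proof.
move=> a0; apply: contrapT => h.
have bad theta : exists fg : (X -> R) * (X -> R), theta \in `]0, a[ ->
    [/\ Phi0 fg.1, Phi0 fg.2, fg.1 <> fg.2 &
     isolation nrm fg.1 * (1 + theta / (k fg.2).+1%:R) =
     isolation nrm fg.2 * (1 + theta / (k fg.1).+1%:R)].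
  have [/andP[t0 ta]|nt] := boolP (theta \in `]0, a[); last by exists (fun=> 0, fun=> 0).
  apply: contrapT => nex; apply: h; exists theta; split => // f g Pf Pg fg.
  by apply/eqP => E; apply: nex; exists (f, g).
have [F FP] := choice bad.
(* If every [theta] were bad, the pair of indices of a violating pair would embed the interval in a
   countable set, against its positive Lebesgue measure. *)
have : countable [set` `]0, a[].
  apply/countable_injP; exists (fun t => choice.pickle (k (F t).1, k (F t).2)) => s t.
  rewrite !inE /= => sa ta /(pcan_inj choice.pickleK)[k1 k2].
  have [Ps1 Ps2 s12 Es] := FP _ sa; have [Pt1 Pt2 t12 Et] := FP _ ta.
  have F1 : (F s).1 = (F t).1 by apply: k_inj0; rewrite ?inE.
  have F2 : (F s).2 = (F t).2 by apply: k_inj0; rewrite ?inE.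
  move: Et; rewrite -F1 -F2 => Et.
  apply: contrapT => st.
  set i := isolation nrm (F s).1 in Es Et; set j := isolation nrm (F s).2 in Es Et.
  have i0 : 0 < i by case: Ps1.
  set p := (k (F s).2).+1%:R^-1 in Es Et; set q := (k (F s).1).+1%:R^-1 in Es Et.
  have ipq : i * p = j * q.
    have : (s - t) * (i * p - j * q) = 0 by nra.
    by move/eqP; rewrite mulf_eq0 !subr_eq0 => /orP[/eqP//|/eqP].
  have ij : i = j.
    have : s * (i * p) = s * (j * q) by rewrite ipq.
    by nra.
  move: ipq; rewrite -ij => /(mulfI (lt0r_neq0 i0)) /invr_inj /eqP.
  rewrite eqr_nat => /eqP[kk]; apply: s12.
  by apply: k_inj0; rewrite ?inE.
move=> /countable_lebesgue_measure0.
by rewrite lebesgue_measure_itv/= lte_fin a0 -EFinD subr0 => /eqP; rewrite eqe gt_eqF.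
Qed.

Variable theta : R.
Hypotheses (theta_gt0 : 0 < theta) (theta_rigid : rigid_parameter theta).

Definition weighted_renorm : X -> R := weighted_norm nrm Phi0 k theta.

Let W := weighted_renorm.
Let MW : Mseminorm W. Proof. exact: weighted_norm_Mseminorm. Qed.
Let w := weight Phi0 k theta.

Lemma weighted_renorm_eq0 x : W x = 0 -> x = 0.
Proof.
move=> Wx; apply: nrm_eq0; apply/eqP; rewrite eq_le (Mseminorm_ge0 MN) andbT -Wx.
exact: weighted_norm_ge.
Qed.

(** [T] carries the weighted [f] to some weighted [g] with the same isolation. The choice of [theta]
    excludes any other [g] in [Phi0]. Outside [Phi0] the weight is 1 and the isolation of [g] is 0
    or 1, whereas that of the weighted [f] lies strictly between. *)
Lemma automorphism_fixes_nonatomic T f : norm_automorphism W T -> Phi0 f -> f \o T = f.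
Proof.
move=> AT Pf; have uf := Phi0_unit Pf.
have [S [AS ST TS]] := automorphism_inverse AT (Mseminorm0 MW) weighted_renorm_eq0.
have uwf : unit_hom W (fun x => w f * f x) by exact: unit_hom_weighted.
have [g ug gE] : exists2 g, unit_hom nrm g & (fun x => w f * f x) \o T = (fun x => w g * g x).
  by apply: (@unit_hom_weightedP _ _ _ MN Phi0 k theta) => //; exact: unit_hom_automorphism.
have : isolation W ((fun x => w f * f x) \o T) = isolation W (fun x => w f * f x).
  exact: isolation_automorphism AT AS ST TS.
rewrite gE /W /weighted_renorm !isolation_weighted// => /eqP.
rewrite eqr_div ?lt0r_neq0 ?weight_gt0// => /eqP E.
have gf : g = f.
  apply: contrapT => gf.
  have [Pg|nPg] := pselect (Phi0 g).
    move: (theta_rigid Pg Pf gf); rewrite -!(weight_in k theta Pf) -!(weight_in k theta Pg).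
    by rewrite E eqxx.
  have if0 : 0 < isolation nrm f by case: Pf.
  have wf1 : 1 < weight Phi0 k theta f.
    by rewrite weight_in// ltrDl divr_gt0.
  move: E; rewrite (weight_notin k theta nPg) mulr1.
  have [ig1|ig1] := ltP (isolation nrm g) 1; last first.
    have := isolation_le1 MN uf; nra.
  have ig0 : isolation nrm g = 0.
    apply/eqP; rewrite eq_le (isolation_ge0 MN ug) andbT leNgt; apply/negP => ig0.
    by apply: nPg; split => //; exact: Phi_isolated.
  by rewrite ig0 mul0r => /esym/eqP; rewrite gt_eqF.
apply/funext => x; have := congr1 (fun h => h x) gE.
by rewrite gf /= => /(mulfI _)->//; rewrite gt_eqF// weight_gt0.
Qed.

(** It suffices that [T] fixes the separating set [Phi]. Members of positive isolation are already
    fixed; any other [f] is determined by its value at an atom, which [T] fixes. *)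
Lemma automorphism_eq_id T : norm_automorphism W T -> (forall e, atom e -> T e = e) ->
  forall x, T x = x.
Proof.
move=> AT Tatom x; apply/eqP; rewrite -subr_eq0; apply: contrapT => /negP.
move=> /Phi_separates[f Pf]; have uf := Phi_unit Pf; have [hf _ _] := uf.
suff fT : f \o T = f by rewrite (lattice_homB hf) -{2}fT subrr eqxx.
have [if0|if0] := ltP 0 (isolation nrm f); first exact: automorphism_fixes_nonatomic.
have {}if0 : isolation nrm f = 0 by apply/eqP; rewrite eq_le if0 (isolation_ge0 MN uf).
have [e ate fe] := isolation_eq0_atom AMX uf if0.
apply: (atom_hom_unique ate) => //; first exact: (lattice_hom_automorphism AT).
by rewrite /= Tatom.
Qed.

Lemma AM_norm_weighted_renorm : AM_norm W.
Proof.
split; first split; first split.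
- exact: MseminormD MW.
- exact: MseminormZ MW.
- exact: weighted_renorm_eq0.
- exact: Mseminorm_mono MW.
- move=> x y x0 y0; apply/eqP; rewrite eq_le (MseminormU MW)//= ge_max.
  by rewrite !(Mseminorm_le MW) ?leUl ?leUr.
Qed.

Definition rigid_norm (N : X -> R) := forall T, norm_automorphism N T -> forall x, T x = x.

Lemma atom_automorphism_scale N T e a : norm_automorphism N T -> is_norm N -> atom e ->
  0 < a -> T e = a *: e -> T e = e.
Proof.
move=> AT [_ NZ N0] [e0 _] a0 Te.
have Ne : N e != 0 by apply/eqP => /N0 e00; move: e0; rewrite e00 ltxx.
have := automorphism_norm AT e; rewrite Te NZ gtr0_norm// => /eqP.
by rewrite -[X in _ == X]mul1r (inj_eq (mulIf Ne)) => /eqP ->; rewrite scale1r.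
Qed.

Lemma weighted_renorm_rigid : at_most_one_atom X -> rigid_norm W.
Proof.
move=> one T AT; apply: automorphism_eq_id => // e ate.
have [S [AS ST TS]] := automorphism_inverse AT (Mseminorm0 MW) weighted_renorm_eq0.
have [a a0 Te] := one _ _ ate (atom_automorphism AT AS ST TS ate).
by apply: (atom_automorphism_scale AT) Te => //; case: AM_norm_weighted_renorm => -[].
Qed.

(** * The additional seminorm for several atoms *)

Section AtomicPart.
Variable delta : R.
Hypothesis delta_gt0 : 0 < delta.

Definition atomic_part : set (X -> R) := [set f | unit_hom nrm f /\ isolation nrm f = 0].

(** Injective on [atomic_part], since members of isolation 0 belong to [Phi]. *)
Let kap f : R := delta / (k f).+1%:R.

(** Sums instead of maxima make the coefficients visible on the span of two atoms, at the price of
    the AM property. *)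
Definition pair_family : set (X -> R) := (fun=> 0) |`
  [set (fun x => kap p.1 * `|p.1 x| + kap p.2 * `|p.2 x|) |
    p in [set p | [/\ atomic_part p.1, atomic_part p.2 & p.1 <> p.2]]].

Definition pair_seminorm : X -> R := psup pair_family.

Let kap_gt0 f : 0 < kap f. Proof. by rewrite divr_gt0. Qed.

Let kap_ge0 f : 0 <= kap f. Proof. exact: ltW. Qed.

Let kap_le f : kap f <= delta.
Proof. by rewrite ler_pdivrMr ?ltr0n// ler_peMr ?(ltW delta_gt0)// ler1n. Qed.

Let F0 : pair_family !=set0. Proof. by exists (fun=> 0); left. Qed.

Let pair_le p x : pair_family p -> p x <= 2 * delta * nrm x.
Proof.
have N0 := Mseminorm_ge0 MN x.
move=> [->|[[f g] /= [[uf _] [ug _] _] <-]]; first by rewrite !mulr_ge0// ltW.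
rewrite [2 * _]mulrC mulr_natr mulr2n mulrDl.
by apply: lerD; apply: ler_pM => //; exact: (unit_hom_norm_le MN).
Qed.

Let Fub x : has_ubound [set p x | p in pair_family].
Proof. by exists (2 * delta * nrm x) => _ [p Fp <-]; exact: pair_le. Qed.

Lemma pair_seminorm_le x : pair_seminorm x <= 2 * delta * nrm x.
Proof. by apply: psup_le => // p; exact: pair_le. Qed.

Lemma pair_seminorm_ge0 x : 0 <= pair_seminorm x.
Proof. by apply: (@psup_ge _ _ _ Fub (fun=> 0)); left. Qed.

Lemma pair_seminorm_ge f g x : atomic_part f -> atomic_part g -> f <> g ->
  kap f * `|f x| + kap g * `|g x| <= pair_seminorm x.
Proof.
move=> Af Ag fg.
apply: (@psup_ge _ _ _ Fub (fun x => kap f * `|f x| + kap g * `|g x|)).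
by right; exists (f, g).
Qed.

Lemma pair_seminormD x y : pair_seminorm (x + y) <= pair_seminorm x + pair_seminorm y.
Proof.
apply: psupD => // _ [->|[[f g] /= [[[hf _ _] _] [[hg _ _] _] _] <-]] {}x {}y.
  by rewrite addr0.
rewrite (lattice_homD hf) (lattice_homD hg) addrACA -!mulrDr.
by apply: lerD; rewrite ler_wpM2l// ler_normD.
Qed.

Lemma pair_seminormZ a x : pair_seminorm (a *: x) = `|a| * pair_seminorm x.
Proof.
apply: psupZ => // _ [->|[[f g] /= [[[hf _ _] _] [[hg _ _] _] _] <-]] {}a {}x.
  by rewrite mulr0.
by rewrite (lattice_homZ hf) (lattice_homZ hg) !normrM mulrDr !(mulrCA `|a|).
Qed.

Lemma pair_seminorm_mono x y : modulus x <= modulus y -> pair_seminorm x <= pair_seminorm y.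
Proof.
apply: psup_mono => // _ [->//|[[f g] /= [[[hf _ _] _] [[hg _ _] _] _] <-]] {}x {}y xy.
rewrite -!lattice_hom_modulus//.
by apply: lerD; rewrite ler_wpM2l//; exact: lattice_hom_le.
Qed.

Definition pair_renorm x : R := W x + pair_seminorm x.

Lemma lattice_norm_pair_renorm : lattice_norm pair_renorm.
Proof.
split; first split.
- by move=> x y; rewrite /pair_renorm addrACA lerD// ?pair_seminormD// (MseminormD MW).
- by move=> a x; rewrite /pair_renorm (MseminormZ MW) pair_seminormZ mulrDr.
- move=> x N0; apply: weighted_renorm_eq0; apply/eqP.
  rewrite eq_le (Mseminorm_ge0 MW) andbT -N0 lerDl; exact: pair_seminorm_ge0.
- by move=> x y xy; rewrite lerD ?pair_seminorm_mono// (Mseminorm_mono MW).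
Qed.

Lemma atom_atomic_part e : atom e -> exists f, atomic_part f /\ f e = nrm e.
Proof.
move=> ate; have e0 : 0 <= e by apply: ltW; case: ate.
have Ne : 0 < nrm e.
  by rewrite normr_gt0; apply/eqP => e00; case: ate; rewrite e00 ltxx.
have [f [uf fe]] := exists_unit_hom MN Ne; have [hf _ _] := uf.
rewrite ger0_norm ?(lattice_hom_ge0 hf)// in fe.
exists f; split => //; split => //; apply: (isolation_atom MN ate uf).
by rewrite fe gt_eqF.
Qed.

(** Only [f] and [f'] are nonzero on this span. Both have weight 1, which gives the maximum, and the
    pair [(f, f')] attains the seminorm. *)
Lemma pair_renorm_atoms e e' f f' a b : atom e -> atom e' -> Order.meet e e' = 0 ->
  atomic_part f -> f e = nrm e -> atomic_part f' -> f' e' = nrm e' -> 0 <= a -> 0 <= b ->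
  pair_renorm (a *: e + b *: e') =
  Num.max (a * nrm e) (b * nrm e') + (kap f * (a * nrm e) + kap f' * (b * nrm e')).
Proof.
move=> ate ate' ee' Af fe Af' fe' a0 b0.
have [uf if0] := Af; have [hf _ _] := uf; have [uf' if0'] := Af'; have [hf' _ _] := uf'.
have norm_gt0 z : atom z -> 0 < nrm z.
  by case=> z0 _; rewrite normr_gt0; apply/eqP => z00; move: z0; rewrite z00 ltxx.
have ne := norm_gt0 _ ate; have ne' := norm_gt0 _ ate'.
have e0 : 0 <= e by apply: ltW; case: ate.
have e'0 : 0 <= e' by apply: ltW; case: ate'.
have disj g : lattice_hom g -> g e != 0 -> g e' = 0.
  move=> hg ge; have := congr1 g ee'; rewrite (lattice_homI hg) (lattice_hom0 hg).
  have := lattice_hom_ge0 hg e0; have := lattice_hom_ge0 hg e'0.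
  have [h|h] := leP (g e) (g e') => ge'0 ge0 ge1; last by [].
  by move: ge; rewrite ge1 eqxx.
have fe'0 : f e' = 0 by apply: disj => //; rewrite fe gt_eqF.
have f'e0 : f' e = 0.
  by apply: contrapT => /eqP/(disj _ hf')/eqP; rewrite fe' gt_eqF.
have ff' : f <> f' by move=> E; move: fe; rewrite E f'e0 => /eqP; rewrite lt_eqF.
have other g : unit_hom nrm g -> g <> f -> g <> f' -> g (a *: e + b *: e') = 0.
  move=> ug gf gf'; have [hg _ _] := ug.
  rewrite (lattice_homD hg) !(lattice_homZ hg).
  have -> : g e = 0.
    apply: contrapT => /eqP ge; apply: gf.
    by apply: (atom_unit_hom_unique MN ate) => //; rewrite fe gt_eqF.
  have -> : g e' = 0.
    apply: contrapT => /eqP ge; apply: gf'.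
    by apply: (atom_unit_hom_unique MN ate') => //; rewrite fe' gt_eqF.
  by rewrite !mulr0 addr0.
have fE : f (a *: e + b *: e') = a * nrm e.
  by rewrite (lattice_homD hf) !(lattice_homZ hf) fe fe'0 mulr0 addr0.
have f'E : f' (a *: e + b *: e') = b * nrm e'.
  by rewrite (lattice_homD hf') !(lattice_homZ hf') fe' f'e0 mulr0 add0r.
have ae : 0 <= a * nrm e by rewrite mulr_ge0// ltW.
have be : 0 <= b * nrm e' by rewrite mulr_ge0// ltW.
have w1 g : isolation nrm g = 0 -> weight Phi0 k theta g = 1.
  by move=> ig; apply: weight_notin => -[_]; rewrite ig ltxx.
congr (_ + _); apply/eqP; rewrite eq_le; apply/andP; split.
- apply: weighted_norm_leP; first by rewrite le_max ae.
  move=> g ug; have [->|gf] := pselect (g = f).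
    by rewrite fE w1// mul1r ger0_norm// le_max lexx.
  have [->|gf'] := pselect (g = f').
    by rewrite f'E w1// mul1r ger0_norm// le_max lexx orbT.
  by rewrite other// normr0 mulr0 le_max ae.
- rewrite ge_max; apply/andP; split.
    rewrite -[X in X <= _]ger0_norm// -fE -[X in X <= _]mul1r -(w1 f)//.
    exact: weighted_norm_hom.
  rewrite -[X in X <= _]ger0_norm// -f'E -[X in X <= _]mul1r -(w1 f')//.
  exact: weighted_norm_hom.
- apply: psup_le => // _ [->|[[g h] /= [[ug _] [uh _] gh] <-]].
    by rewrite addr_ge0// mulr_ge0.
  (* The two terms record whether [q] is [f] or [f']; as the members of a pair differ, each is
     counted at most once in the sum. *)
  have val q : unit_hom nrm q -> kap q * `|q (a *: e + b *: e')| =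
      (if pselect (q = f) then kap f * (a * nrm e) else 0) +
      (if pselect (q = f') then kap f' * (b * nrm e') else 0).
    move=> uq; case: pselect => [qf|qf]; case: pselect => [qf'|qf'] /=.
    - by case: ff'; rewrite -qf.
    - by rewrite qf fE ger0_norm// addr0.
    - by rewrite qf' f'E ger0_norm// add0r.
    - by rewrite other// normr0 mulr0 addr0.
  have A0 : 0 <= kap f * (a * nrm e) by rewrite mulr_ge0.
  have B0 : 0 <= kap f' * (b * nrm e') by rewrite mulr_ge0.
  rewrite !val// addrACA; apply: lerD.
    case: pselect => [gf|gf]; case: pselect => [hf0|hf0] //=; rewrite ?addr0 ?add0r//.
    by case: gh; rewrite gf hf0.
  case: pselect => [gf|gf]; case: pselect => [hf0|hf0] //=; rewrite ?addr0 ?add0r//.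
  by case: gh; rewrite gf hf0.
- by have := pair_seminorm_ge (a *: e + b *: e') Af Af' ff'; rewrite fE f'E !ger0_norm.
Qed.

Lemma not_one_atom_disjoint e : ~ at_most_one_atom X -> atom e ->
  exists e', atom e' /\ Order.meet e e' = 0.
Proof.
move=> many ate; apply: contrapT => nex; apply: many => g h atg ath.
have prop (z : X) : atom z -> exists2 a, 0 < a & z = a *: e.
  move=> atz; have [//|ez] := atoms_proportional_or_disjoint ate atz.
  by case: nex; exists z.
have [a a0 gE] := prop _ atg; have [b b0 hE] := prop _ ath.
exists (b / a); first by rewrite divr_gt0.
by rewrite gE hE scalerA divfK// gt_eqF.
Qed.

(** Comparing the norm on the spans of [e], [e'] and of [T e], [T e'] shows that the functionals of
    [e] and [T e] have equal [kap], hence coincide. So [T e] is not disjoint from [e] and must be a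
    multiple of it; the factor is 1 by isometry. *)
Lemma pair_renorm_rigid : ~ at_most_one_atom X -> rigid_norm pair_renorm.
Proof.
move=> many T AT.
have [[ND NZ N_eq0] _] := lattice_norm_pair_renorm.
have N_0 : pair_renorm 0 = 0 by rewrite -[X in pair_renorm X](scale0r 0) NZ normr0 mul0r.
have [S [AS ST TS]] := automorphism_inverse AT N_0 N_eq0.
have Tatom e : atom e -> T e = e.
  move=> ate; have [e' [ate' ee']] := not_one_atom_disjoint many ate.
  have atT := atom_automorphism AT AS ST TS ate.
  have atT' := atom_automorphism AT AS ST TS ate'.
  have TT : Order.meet (T e) (T e') = 0.
    by rewrite -(automorphismI AT) ee' (automorphism0 AT).
  have [f [Af fe]] := atom_atomic_part ate.
  have [f' [Af' fe']] := atom_atomic_part ate'.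
  have [g [Ag gTe]] := atom_atomic_part atT.
  have [g' [Ag' gTe']] := atom_atomic_part atT'.
  have norm_gt0 z : atom z -> 0 < nrm z.
    by case=> z0 _; rewrite normr_gt0; apply/eqP => z00; move: z0; rewrite z00 ltxx.
  have eq a b : 0 <= a -> 0 <= b ->
      Num.max (a * nrm e) (b * nrm e') + (kap f * (a * nrm e) + kap f' * (b * nrm e')) =
      Num.max (a * nrm (T e)) (b * nrm (T e')) +
      (kap g * (a * nrm (T e)) + kap g' * (b * nrm (T e'))).
    move=> a0 b0; rewrite -!pair_renorm_atoms// -(automorphism_norm AT).
    by rewrite (automorphismD AT) !(automorphismZ AT).
  have p0 := norm_gt0 _ ate; have p'0 := norm_gt0 _ atT.
  have q0 := norm_gt0 _ ate'; have q'0 := norm_gt0 _ atT'.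
  have [pp kk] : nrm e = nrm (T e) /\ kap f = kap g.
    move: (nrm e) (nrm e') (nrm (T e)) (nrm (T e')) (kap f) (kap f') (kap g) (kap g')
      (kap_gt0 f) (kap_gt0 g) eq p0 p'0 q0 q'0.
    move=> p q p' q' s t s' t' s0 s'0 eq p0 p'0 q0 q'0.
    (* For this [B] both maxima at [(1, B)] are attained by the second atom, so
       comparing with [(0, B)] isolates the coefficient of the first one. *)
    pose B := p / q + p' / q'.
    have B0 : 0 <= B by rewrite addr_ge0// divr_ge0// ltW.
    have Bq : p <= B * q by rewrite -ler_pdivrMr// lerDl divr_ge0// ltW.
    have Bq' : p' <= B * q' by rewrite -ler_pdivrMr// lerDr divr_ge0// ltW.
    have e1 := eq 1 0 ler01 (lexx 0); have e2 := eq 0 B (lexx 0) B0.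
    have e3 := eq 1 B ler01 B0.
    move: e1 e2 e3; rewrite !mul0r !mul1r !mulr0 !addr0 !add0r.
    have Bq0 : 0 <= B * q by rewrite mulr_ge0// ltW.
    have Bq'0 : 0 <= B * q' by rewrite mulr_ge0// ltW.
    rewrite (max_l (ltW p0)) (max_l (ltW p'0)) (max_r Bq0) (max_r Bq'0).
    rewrite (max_r Bq) (max_r Bq').
    move=> e1 e2 e3.
    have sp : s * p = s' * p' by lra.
    have pp' : p = p' by lra.
    split => //; apply: (mulIf (lt0r_neq0 p0)); rewrite sp.
    by rewrite pp'.
  have fg : f = g.
    have [uf if0] := Af; have [ug ig0] := Ag.
    apply: k_inj; rewrite ?inE.
    - by apply: Phi_isolated; rewrite ?if0.
    - by apply: Phi_isolated; rewrite ?ig0.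
    move: kk => /(mulfI (lt0r_neq0 delta_gt0))/invr_inj/eqP.
    by rewrite eqr_nat => /eqP[].
  have [[a a0 Te]|dis] := atoms_proportional_or_disjoint ate atT.
    by apply: (atom_automorphism_scale AT) Te => //; case: lattice_norm_pair_renorm.
  have [[hf _ _] _] := Af.
  have := congr1 f dis; rewrite (lattice_homI hf) (lattice_hom0 hf) fe fg gTe pp minxx => h.
  by move: p'0; rewrite h ltxx.
apply: automorphism_eq_id => //; have [TD TZ TU TN Tsurj] := AT; split => // x.
(* With all atoms fixed, so are their functionals, and the seminorm is invariant. Subtracting it
   from the norm leaves an isometry of [W], to which [automorphism_eq_id] applies. *)
suff E : pair_seminorm (T x) = pair_seminorm x.
  by have := TN x; rewrite /pair_renorm E => /addIr.
have fT f : atomic_part f -> f (T x) = f x.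
  move=> [uf if0]; have [hf _ _] := uf.
  have [e ate fe] := isolation_eq0_atom AMX uf if0.
  have : f \o T = f.
    apply: (atom_hom_unique ate) => //; first exact: (lattice_hom_automorphism AT).
    by rewrite /= Tatom.
  by move=> /(congr1 (fun h => h x)).
have pT p : pair_family p -> p (T x) = p x.
  by move=> [->//|[[f g] /= [Af Ag _] <-]]; rewrite !fT.
congr sup; apply/seteqP; split => _ [p Fp <-]; exists p => //; by rewrite pT.
Qed.

End AtomicPart.

End Renormings.

(** * Choice of constants and assembly *)

Section Conclusion.
Context (R : realType) (X : banachLatticeType R).

Lemma rigid_renormingP (c : R) (N : X -> R) : lattice_norm N ->
  (forall x, `|x| <= N x <= c * `|x|) -> 0 < c -> rigid_norm N -> rigid_renorming c N.
Proof.
move=> NN Nc c0 Nr; split => //.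
  by exists 1, c; split => // x; rewrite mul1r.
move=> T; split.
  move=> [Tsurj TN TU _]; apply: Nr; split => //.
  - exact: raddfD.
  - by move=> a x; rewrite linearZ.
  - by move=> y; have [x _ <-] := Tsurj y I; exists x.
move=> Tid; split => //.
- by move=> y _; exists y.
- by move=> x; rewrite Tid.
- by move=> x y; rewrite !Tid.
- by move=> x y; rewrite !Tid.
Qed.

End Conclusion.

Theorem theorem1p1 (R : realType) (X : banachLatticeType R) (c : R)
    (AMX : AM_space X) (sepX : separable_space X) (c_gt1 : 1 < c) :
  (exists N : X -> R, rigid_renorming c N) /\
  (at_most_one_atom X ->
   exists N : X -> R, rigid_renorming c N /\ AM_norm N).
Proof.
have [Phi [Phi_unit [k k_inj] Phi_iso Phi_sep]] := separating_countable_unit_homs AMX sepX.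
(* Half of the slack [c - 1] goes to the weights; the other half is kept for the pair seminorm,
   which with [delta = (c - 1) / 4] costs at most [2 * delta]. *)
have c2 : 0 < (c - 1) / 2 by rewrite divr_gt0// subr_gt0.
have [theta [theta0 thetac theta_rigid]] := exists_rigid_parameter k_inj c2.
have MN := AM_space_Mseminorm AMX.
have Wle (x : X) : weighted_renorm Phi k theta x <= (1 + theta) * `|x|.
  by apply: weighted_norm_le => //.
have Wge (x : X) : `|x| <= weighted_renorm Phi k theta x.
  by apply: weighted_norm_ge.
have AMW : AM_norm (weighted_renorm Phi k theta) by exact: AM_norm_weighted_renorm.
have one : at_most_one_atom X -> exists N : X -> R, rigid_renorming c N /\ AM_norm N.
  move=> one; exists (weighted_renorm Phi k theta); split => //.
  apply: rigid_renormingP; [by case: AMW| |by lra|exact: weighted_renorm_rigid].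
  move=> x; rewrite Wge; apply: le_trans (Wle x) _; rewrite ler_wpM2r//; lra.
split => //.
have [atmost|many] := pselect (at_most_one_atom X); first by have [N [? _]] := one atmost; exists N.
have d0 : 0 < (c - 1) / 4 by rewrite divr_gt0// subr_gt0.
exists (pair_renorm Phi k theta ((c - 1) / 4)).
apply: rigid_renormingP; [exact: lattice_norm_pair_renorm| |by lra|exact: pair_renorm_rigid].
move=> x; apply/andP; split.
  by apply: le_trans (Wge x) _; rewrite lerDl pair_seminorm_ge0.
have Sle : pair_seminorm k ((c - 1) / 4) x <= 2 * ((c - 1) / 4) * `|x|.
  exact: pair_seminorm_le.
have := Wle x; have := normr_ge0 x; rewrite /pair_renorm; nra.
Qed.
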